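(* Let $M,m$ be coprime positive integers and $m_2\in\mathbf Z$ with $0\le m_2\le m-1$. Let $\Omega^{(\mathrm I)}=\{(k_1,k_2)\in(\mathbf Z_{\ge0})^2:\ 2k_1+k_2\le M-2\}$ and $\Omega^{(\mathrm{III})}=\{(k_1,k_2)\in\mathbf Z_{\ge 0}\times\mathbf Z_{\ge1}:\ 2k_1+k_2\le M-2\}$. Write $\ddot H(\heartsuit)=\overset{N=4}{\ddot H}(\Lambda^{(M)(m,m_2)(\heartsuit)}_{k_1,k_2})$ with $(k_1,k_2)\in\Omega^{(\heartsuit)}$, $\heartsuit\in\{\mathrm I,\mathrm{III}\}$, and $H_2=\overset{N=2}H(\lambda^{(M)[m-1,m_2]}_{k_1,k_1+k_2})$. Put $D(\tau,z)=\prod_{n=1}^\infty(1-e^{4\pi iz}q^{n-1})(1-e^{-4\pi iz}q^n)$. Then: (I) (i) $\mathrm{ch}^{(+)}_{\ddot H(\mathrm I)}(\tau,z)=-q^{-\frac18}e^{2\pi iz}\,\mathrm{ch}^{(+)}_{H_2}(\tau,z)\cdot\dfrac{\prod_{n=1}^\infty(1+e^{2\pi iz}q^{n-\frac12})(1+e^{-2\pi iz}q^{n-\frac12})}{D(\tau,z)}$; (ii) $\mathrm{ch}^{(-)}_{\ddot H(\mathrm I)}(\tau,z)=-q^{-\frac18}e^{2\pi iz}\,\mathrm{ch}^{(-)}_{H_2}(\tau,z)\cdot\dfrac{\prod_{n=1}^\infty(1-e^{2\pi iz}q^{n-\frac12})(1-e^{-2\pi iz}q^{n-\frac12})}{D(\tau,z)}$.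 (III) (i) $\mathrm{ch}^{(+)}_{\ddot H(\mathrm{III})}(\tau,z)=-q^{-\frac18}e^{2\pi iz}\,\mathrm{ch}^{(+)}_{H_2}(\tau,-z)\cdot\dfrac{\prod_{n=1}^\infty(1+e^{2\pi iz}q^{n-\frac12})(1+e^{-2\pi iz}q^{n-\frac12})}{D(\tau,z)}$; (ii) $\mathrm{ch}^{(-)}_{\ddot H(\mathrm{III})}(\tau,z)=-q^{-\frac18}e^{2\pi iz}\,\mathrm{ch}^{(-)}_{H_2}(\tau,-z)\cdot\dfrac{\prod_{n=1}^\infty(1-e^{2\pi iz}q^{n-\frac12})(1-e^{-2\pi iz}q^{n-\frac12})}{D(\tau,z)}$. $(\mathrm I)^{\mathrm{tw}}$ (i) $\mathrm{ch}^{(+)\mathrm{tw}}_{\ddot H(\mathrm I)}(\tau,z)=-e^{\pi iz}\cdot\mathrm{ch}^{(+)\mathrm{tw}}_{H_2}(\tau,-z)\cdot\dfrac{\prod_{n=1}^\infty(1+e^{2\pi iz}q^{n-1})(1+e^{-2\pi iz}q^{n})}{D(\tau,z)}$; (ii) $\mathrm{ch}^{(-)\mathrm{tw}}_{\ddot H(\mathrm I)}(\tau,z)=-i\,e^{\pi iz}\cdot\mathrm{ch}^{(-)\mathrm{tw}}_{H_2}(\tau,-z)\cdot\dfrac{\prod_{n=1}^\infty(1-e^{2\pi iz}q^{n-1})(1-e^{-2\pi iz}q^{n})}{D(\tau,z)}$.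
   Context: Functions. $q=e^{2\pi i\tau}$, $q^a=e^{2\pi ia\tau}$. For $m\in\frac12\mathbf Z_{>0}$, $s\in\frac12\mathbf Z$: $\Phi^{[m,s]}_1(\tau,z_1,z_2,t)=e^{-2\pi imt}\sum_{j\in\mathbf Z}\frac{e^{2\pi imj(z_1+z_2)+2\pi isz_1}q^{mj^2+sj}}{1-e^{2\pi iz_1}q^j}$, $\Phi^{[m,s]}_2(\tau,z_1,z_2,t)=e^{-2\pi imt}\sum_{j\in\mathbf Z}\frac{e^{-2\pi imj(z_1+z_2)-2\pi isz_2}q^{mj^2+sj}}{1-e^{-2\pi iz_2}q^j}$, $\Phi^{[m,s]}=\Phi^{[m,s]}_1-\Phi^{[m,s]}_2$. For $\varepsilon,\varepsilon'\in\{0,\frac12\}$ and $j,k\in\varepsilon'+\mathbf Z$: $\Psi^{[M,m,s;\varepsilon]}_{j,k;\varepsilon'}(\tau,z_1,z_2,t)=q^{\frac mMjk}e^{\frac{2\pi im}{M}(kz_1+jz_2)}\Phi^{[m,s]}(M\tau,z_1+j\tau+\varepsilon,z_2+k\tau-\varepsilon,\frac tM)$. $\vartheta_{ab}(\tau,z)=\sum_{n\in\mathbf Z}e^{\pi i(n+\frac a2)^2\tau+2\pi i(n+\frac a2)(z+\frac b2)}$ (Mumford), $\eta(\tau)=q^{1/24}\prod_{n\ge1}(1-q^n)$. Affine superalgebra. $\widehat A(1,1)$ is the affine Lie superalgebra of $sl(2|2)/\mathbf CI$ with simple roots $\alpha_0,\alpha_2$ (even), $\alpha_1,\alpha_3$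 (odd), and $(\alpha_0|\alpha_0)=2$, $(\alpha_2|\alpha_2)=-2$, $(\alpha_1|\alpha_1)=(\alpha_3|\alpha_3)=(\alpha_1|\alpha_3)=(\alpha_0|\alpha_2)=0$, $(\alpha_0|\alpha_1)=(\alpha_0|\alpha_3)=-1$, $(\alpha_1|\alpha_2)=(\alpha_2|\alpha_3)=1$ (so $\alpha_1,\alpha_3$ coincide as functions on the Cartan subalgebra). $\delta=\sum_{i=0}^3\alpha_i$, $\theta=\alpha_1+\alpha_2+\alpha_3$, $(\Lambda_0|\alpha_j)=\delta_{j,0}$, $(\Lambda_0|\Lambda_0)=0$, $\rho=-\frac12(\alpha_1+\alpha_3)$, dual Coxeter number $0$. The Cartan subalgebra is identified with its dual via $(\cdot|\cdot)$, with coordinates $(\tau,z_1,z_2,t)=2\pi i(-\tau\Lambda_0+z+t\delta)$, $z=-\frac{z_1-z_2}2(\alpha_1+\alpha_3)-z_1\alpha_2$; thus $e^{-\alpha_1}=e^{-\alpha_3}=e^{2\pi iz_1}$, $e^{-\alpha_2}=e^{-2\pi i(z_1+z_2)}$, $e^{\Lambda_0}=e^{2\pi it}$, $e^{-\delta}=q$. Put $t_\alpha(\lambda)=\lambda+(\lambda|\delta)\alpha-\{\frac{(\alpha|\alpha)}2(\lambda|\delta)+(\lambda|\alpha)\}\delta$, $r_\theta(\lambda)=\lambda-(\lambda|\theta)\theta$, $r_{\alpha_2}(\lambda)=\lambda+(\lambda|\alpha_2)\alpha_2$, and $w.\lambda=w(\lambda+\rho)-\rho$. Characters of modules. All characters are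 normalized (super)characters ($+$: character, $-$: supercharacter), $\widehat R^{(\pm)}$ is the (super)denominator, and ''numerator'' means the product $\widehat R^{(\pm)}\mathrm{ch}^{(\pm)}$. They are given by the following formulas. For $0\le m_2\le m$ let $\Lambda^{(m,m_2)}=m\Lambda_0+\frac{m_2}2(\alpha_1+\alpha_3)$ and $F^{(\pm)}=\sum_{j\in\mathbf Z}t_{j\theta}\Big(\frac{e^{\Lambda^{(m,m_2)}+\rho}}{(1\pm e^{-\alpha_1})(1\pm e^{-\alpha_3})}\Big)$; then $\widehat R^{(\pm)}\mathrm{ch}^{(\pm)}_{L(\Lambda^{(m,m_2)})}=F^{(\pm)}-r_\theta F^{(\pm)}$. For $\beta=\beta[b_1,b_2]:=-\frac{b_1-b_2}2(\alpha_1+\alpha_3)-b_1\alpha_2$ and a type $\heartsuit$ put: (I) $\overline y=1$, $\beta=\beta[k_1,-(k_1+k_2)]$; (III) $\overline y=r_{\alpha_2}$, $\beta=\beta[k_1+k_2,-k_1]$. The principal admissible weight is $\Lambda^{(M)(m,m_2)(\heartsuit)}_{k_1,k_2}=(t_\beta\overline y).(\Lambda^{(m,m_2)}-(M-1)\frac mM\Lambda_0)$ and its irreducible highest weight module has $[\widehat R^{(\pm)}\mathrm{ch}^{(\pm)}_{L(\Lambda^{(M)(m,m_2)(\heartsuit)}_{k_1,k_2})}](\tau,z,t)=[\widehat R^{(\pm)}\mathrm{ch}^{(\pm)}_{L(\Lambda^{(m,m_2)})}]\big(M\tau,\overline y^{-1}(z+\tau\beta),\frac1M(t+(z|\beta)+\frac{\tau|\beta|^2}2)\big)$.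 Twisted functions are $f^{\mathrm{tw}}(h)=f(w_0h)$ with $w_0=r_{\alpha_2}t_{-\frac12\alpha_2}$, i.e. $w_0(\tau,z_1,z_2,t)=(\tau,-z_2+\frac\tau2,-z_1+\frac\tau2,t+\frac{z_1+z_2}2-\frac\tau4)$. For $0\le m_2\le m-1$, $\ddot L(\Lambda^{(M)(m,m_2)(\heartsuit)}_{k_1,k_2})=L(\Lambda^{(M)(m,m_2)(\heartsuit)}_{k_1,k_2})\oplus L(\Lambda^{(M)(m,m_2+1)(\heartsuit)}_{k_1,k_2})$, with $\mathrm{ch}^{(\pm)}_{\ddot L}=\mathrm{ch}^{(\pm)}_{L(\Lambda^{(M)(m,m_2)(\heartsuit)}_{k_1,k_2})}\pm\mathrm{ch}^{(\pm)}_{L(\Lambda^{(M)(m,m_2+1)(\heartsuit)}_{k_1,k_2})}$ and the same for twisted characters. N=4 characters. $\overset{N=4}{\ddot H}(\Lambda)$ is the quantum Hamiltonian reduction of $\ddot L(\Lambda)$ for $(x=\frac12\theta,f=e_{-\theta})$, a module of the N=4 superconformal algebra of central charge $-6(\frac mM+1)$. Its characters are given by $[\overset{N=4}R{}^{(\pm)}\mathrm{ch}^{(\pm)}_{\ddot H}](\tau,z)=[\widehat R^{(\pm)}\mathrm{ch}^{(\pm)}_{\ddot L}](\tau,z+\frac\tau2,z-\frac\tau2,\frac\tau4)$, and likewise with ''tw'' throughout, where the N=4 denominators are $\overset{N=4}R{}^{(+)}=-i\frac{\eta(\tau)^3\vartheta_{11}(\tau,2z)}{\vartheta_{00}(\tau,z)^2}$,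 $\overset{N=4}R{}^{(-)}=i\frac{\eta(\tau)^3\vartheta_{11}(\tau,2z)}{\vartheta_{01}(\tau,z)^2}$, $\overset{N=4}R{}^{(+)\mathrm{tw}}=-i\frac{\eta(\tau)^3\vartheta_{11}(\tau,2z)}{\vartheta_{10}(\tau,z)^2}$, $\overset{N=4}R{}^{(-)\mathrm{tw}}=i\frac{\eta(\tau)^3\vartheta_{11}(\tau,2z)}{\vartheta_{11}(\tau,z)^2}$. N=2 characters. Let $\widehat{sl}(2|1)$ have simple roots $\alpha_0$ (even), $\alpha_1,\alpha_2$ (odd) with $(\alpha_0|\alpha_0)=2$, $(\alpha_0|\alpha_1)=(\alpha_0|\alpha_2)=-1$, $(\alpha_1|\alpha_2)=1$, $(\alpha_1|\alpha_1)=(\alpha_2|\alpha_2)=0$ and $\delta=\alpha_0+\alpha_1+\alpha_2$. For integers $0\le m_2\le m'$, $k_1,k_2\ge0$, $k_1+k_2\le M-1$, $\gcd(M,m'+1)=1$ and $K=\frac{m'+1}M-1$, $\lambda^{(M)[m',m_2]}_{k_1,k_2}=K\Lambda_0-(K+1)k_1\alpha_2-(K+1)(k_2-\frac{m_2}{K+1})\alpha_1-(K+1)k_1(k_2-\frac{m_2}{K+1})\delta$ is a principal admissible weight of level $K$. $\overset{N=2}H(\lambda)$ denotes the quantum Hamiltonian reduction of the irreducible highest weight module $L(\lambda)$ with $x=\frac12(\alpha_1+\alpha_2)$ and the minimal nilpotent element, a module of the N=2 superconformal algebra; ''tw'' refers to the Ramond twisted module. Its normalized (super)characters, for $\lambda=\lambda^{(M)[m',m_2]}_{k_1,k_2}$,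 are (known formulas) $\mathrm{ch}^{(+)}(\tau,z)=(-1)^{m_2}\Psi^{[M,m'+1,-m_2;\frac12]}_{k_1+\frac12,k_2+\frac12;\frac12}(\tau,z,-z,0)\frac{\vartheta_{00}(\tau,z)}{\eta(\tau)^3}$, $\mathrm{ch}^{(-)}(\tau,z)=\Psi^{[M,m'+1,-m_2;0]}_{k_1+\frac12,k_2+\frac12;\frac12}(\tau,z,-z,0)\frac{\vartheta_{01}(\tau,z)}{\eta(\tau)^3}$, $\mathrm{ch}^{(+)\mathrm{tw}}(\tau,z)=(-1)^{m_2}\Psi^{[M,m'+1,-m_2;\frac12]}_{k_1+1,k_2;0}(\tau,z,-z,0)\frac{\vartheta_{10}(\tau,z)}{\eta(\tau)^3}$, $\mathrm{ch}^{(-)\mathrm{tw}}(\tau,z)=\Psi^{[M,m'+1,-m_2;0]}_{k_1+1,k_2;0}(\tau,z,-z,0)\frac{\vartheta_{11}(\tau,z)}{\eta(\tau)^3}$. *)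

(* Defs.v *)
(* Vanilla Stdlib reals, with Coquelicot's complex numbers and total limits. *)
From Stdlib Require Export Reals ZArith.
From Coquelicot Require Export Coquelicot.

Open Scope C_scope.

Definition ZtoC (n : Z) : C := RtoC (IZR n).
Coercion ZtoC : Z >-> C.

(** * Series, products and exponentials of complex numbers *)

Definition Cexp (x : C) : C :=
  ((exp (Re x) * cos (Im x))%R, (exp (Re x) * sin (Im x))%R).

(* e2pi x = e^{2 pi i x}, so that q^a is e2pi (a * tau). *)
Definition e2pi (x : C) : C := Cexp (2 * PI * Ci * x).
Definition qpow (tau a : C) : C := e2pi (a * tau).

Definition CSeries (u : nat -> C) : C :=
  (Series (fun n => Re (u n)), Series (fun n => Im (u n))).

Definition sumZ (f : Z -> C) : C :=
  CSeries (fun n => f (Z.of_nat n)) + CSeries (fun n => f (- Z.of_nat (S n))%Z).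

Fixpoint Cprod_upto (f : nat -> C) (N : nat) : C :=
  match N with
  | O => 1
  | S n => Cprod_upto f n * f (S n)
  end.

(* Infinite product over n >= 1; the argument of f is n. *)
Definition Cprod (f : nat -> C) : C :=
  (real (Lim_seq (fun N => Re (Cprod_upto f N))),
   real (Lim_seq (fun N => Im (Cprod_upto f N)))).

(** * Theta functions, and the functions Phi and Psi *)

Definition theta (a b : Z) (tau z : C) : C :=
  sumZ (fun n => Cexp (PI * Ci * (n + a / 2) ^ 2 * tau
                       + 2 * PI * Ci * (n + a / 2) * (z + b / 2))).

Definition eta (tau : C) : C :=
  qpow tau (1 / 24) * Cprod (fun n => 1 - qpow tau (INR n)).

(* The half-integral parameters m, s, eps, j, k are real numbers. *)
Definition Phi1 (m s : R) (tau z1 z2 t : C) : C :=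
  e2pi (- m * t) *
  sumZ (fun j => e2pi (m * j * (z1 + z2) + s * z1) * qpow tau (m * j ^ 2 + s * j)
                 / (1 - e2pi z1 * qpow tau j)).

Definition Phi2 (m s : R) (tau z1 z2 t : C) : C :=
  e2pi (- m * t) *
  sumZ (fun j => e2pi (- m * j * (z1 + z2) - s * z2) * qpow tau (m * j ^ 2 + s * j)
                 / (1 - e2pi (- z2) * qpow tau j)).

Definition Phi (m s : R) (tau z1 z2 t : C) : C :=
  Phi1 m s tau z1 z2 t - Phi2 m s tau z1 z2 t.

(* The index eps' of Psi only records the class of j and k modulo Z, and does
   not occur in the formula. *)
Definition Psi (M : Z) (m s eps j k : R) (tau z1 z2 t : C) : C :=
  qpow tau (m / M * j * k) * e2pi (m / M * (k * z1 + j * z2)) *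
  Phi m s (M * tau) (z1 + j * tau + eps) (z2 + k * tau - eps) (t / M).

(** * The Cartan subalgebra of the affine superalgebra A(1,1)^ *)

(* cL Lambda_0 + c1 alpha_1 + c2 alpha_2 + cd delta; the Cartan subalgebra is
   identified with its dual.  As functions on it alpha_3 = alpha_1, hence
   alpha_0 = delta - 2 alpha_1 - alpha_2. *)
Record hvec := Hvec { cL : C; c1 : C; c2 : C; cd : C }.

Definition hadd (u v : hvec) : hvec :=
  Hvec (cL u + cL v) (c1 u + c1 v) (c2 u + c2 v) (cd u + cd v).
Definition hscal (a : C) (u : hvec) : hvec :=
  Hvec (a * cL u) (a * c1 u) (a * c2 u) (a * cd u).

Declare Scope hvec_scope.
Delimit Scope hvec_scope with H.
Bind Scope hvec_scope with hvec.
Infix "+" := hadd : hvec_scope.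
Notation "a *: u" := (hscal a%C u) (at level 40, u at level 39) : hvec_scope.
Notation "u - v" := (hadd u (hscal (-1)%C v)) : hvec_scope.

Definition form (u v : hvec) : C :=
  cL u * cd v + cd u * cL v + c1 u * c2 v + c2 u * c1 v - 2 * c2 u * c2 v.

Definition Lambda0 : hvec := Hvec 1 0 0 0.
Definition alpha1 : hvec := Hvec 0 1 0 0.
Definition alpha2 : hvec := Hvec 0 0 1 0.
Definition alpha3 : hvec := alpha1.
Definition delta : hvec := Hvec 0 0 0 1.
Definition theta_root : hvec := (alpha1 + alpha2 + alpha3)%H.
Definition alpha0 : hvec := (delta - theta_root)%H.
Definition rho : hvec := ((- (1 / 2)) *: (alpha1 + alpha3))%H.

Lemma form_alpha :
  form alpha0 alpha0 = 2 /\ form alpha2 alpha2 = - (2) /\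
  form alpha1 alpha1 = 0 /\ form alpha3 alpha3 = 0 /\
  form alpha1 alpha3 = 0 /\ form alpha0 alpha2 = 0 /\
  form alpha0 alpha1 = - (1) /\ form alpha0 alpha3 = - (1) /\
  form alpha1 alpha2 = 1 /\ form alpha2 alpha3 = 1 /\
  form Lambda0 Lambda0 = 0 /\ form Lambda0 alpha0 = 1 /\
  form Lambda0 alpha1 = 0 /\ form Lambda0 alpha2 = 0 /\ form Lambda0 alpha3 = 0.
Proof. unfold form; simpl; repeat split; ring. Qed.

Definition t_ (a l : hvec) : hvec :=
  (l + form l delta *: a - (form a a / 2 * form l delta + form l a) *: delta)%H.
Definition r_theta (l : hvec) : hvec := (l - form l theta_root *: theta_root)%H.
Definition r_alpha2 (l : hvec) : hvec := (l + form l alpha2 *: alpha2)%H.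

(* zvec z1 z2 is both the element z with coordinates (z1, z2) and beta[z1, z2]. *)
Definition zvec (z1 z2 : C) : hvec :=
  ((- ((z1 - z2) / 2)) *: (alpha1 + alpha3) - z1 *: alpha2)%H.

Definition point (tau : C) (z : hvec) (t : C) : hvec :=
  ((2 * PI * Ci) *: ((- tau) *: Lambda0 + z + t *: delta))%H.

Definition hexp (l h : hvec) : C := Cexp (form l h).

(* (w f)(h) = f (w^-1 h), so that w e^l = e^(w l). *)
Definition act (winv : hvec -> hvec) (f : hvec -> C) (h : hvec) : C := f (winv h).

(** * Characters of A(1,1)^-modules *)

(* Plus: characters; Minus: supercharacters. *)
Inductive sign := Plus | Minus.
Definition sgn (s : sign) : C := match s with Plus => 1 | Minus => - (1) end.

Inductive sector := untwisted | twisted.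

Inductive heart := typeI | typeIII.

Definition ybar (ty : heart) : hvec -> hvec :=
  match ty with typeI => fun l => l | typeIII => r_alpha2 end.
Definition ybar_inv (ty : heart) : hvec -> hvec := ybar ty.

Definition beta (ty : heart) (k1 k2 : Z) : hvec :=
  match ty with
  | typeI => zvec k1 (- (k1 + k2))
  | typeIII => zvec (k1 + k2) (- k1)
  end.

Definition Lambda (m m2 : Z) : hvec :=
  (m *: Lambda0 + (m2 / 2) *: (alpha1 + alpha3))%H.

(* (t_beta ybar).(Lambda^(m,m2) - (M-1) (m/M) Lambda_0), where w.l = w(l+rho) - rho.
   The functions below are indexed by the parameters of this weight. *)
Definition Lambda_adm (M m m2 : Z) (ty : heart) (k1 k2 : Z) : hvec :=
  let l := (Lambda m m2 - ((M - 1) * (m / M)) *: Lambda0)%H in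
  (t_ (beta ty k1 k2) (ybar ty (l + rho)) - rho)%H.

(* t_(-j theta) is the inverse of t_(j theta). *)
Definition F_num (s : sign) (m m2 : Z) (h : hvec) : C :=
  sumZ (fun j =>
    act (t_ ((- j) *: theta_root)%H)
      (fun g => hexp (Lambda m m2 + rho) g
                / ((1 + sgn s * hexp ((-1) *: alpha1) g)
                   * (1 + sgn s * hexp ((-1) *: alpha3) g))) h).

(* R^ ch for L(Lambda^(m,m2)) *)
Definition num_L (s : sign) (m m2 : Z) (h : hvec) : C :=
  F_num s m m2 h - act r_theta (F_num s m m2) h.

(* R^ ch for L(Lambda_adm M m m2 ty k1 k2) *)
Definition num_L_adm (s : sign) (M m m2 : Z) (ty : heart) (k1 k2 : Z)
    (tau : C) (z : hvec) (t : C) : C :=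
  let b := beta ty k1 k2 in
  num_L s m m2
    (point (M * tau) (ybar_inv ty (z + tau *: b)%H)
           (1 / M * (t + form z b + tau * form b b / 2))).

(* R^ ch for the direct sum of the modules with parameters m2 and m2 + 1 *)
Definition num_Lddot (s : sign) (M m m2 : Z) (ty : heart) (k1 k2 : Z)
    (tau : C) (z : hvec) (t : C) : C :=
  num_L_adm s M m m2 ty k1 k2 tau z t
  + sgn s * num_L_adm s M m (m2 + 1)%Z ty k1 k2 tau z t.

(* w0 = r_(alpha_2) t_(-alpha_2/2) in coordinates: f^tw = f o w0 *)
Definition twist (f : C -> C -> C -> C -> C) (tau z1 z2 t : C) : C :=
  f tau (- z2 + tau / 2) (- z1 + tau / 2) (t + (z1 + z2) / 2 - tau / 4).

Lemma twist_w0 tau z1 z2 t :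
  r_alpha2 (t_ ((- (1 / 2)) *: alpha2)%H (point tau (zvec z1 z2) t)) =
  point tau (zvec (- z2 + tau / 2) (- z1 + tau / 2))
        (t + (z1 + z2) / 2 - tau / 4).
Proof.
assert (n2 : RtoC 2 <> 0) by (intro H; now apply RtoC_inj, eq_IZR in H).
assert (n4 : RtoC 4 <> 0) by (intro H; now apply RtoC_inj, eq_IZR in H).
assert (Hr : forall a b c d, r_alpha2 (Hvec a b c d) = Hvec a b (b - c) d).
{ intros; unfold r_alpha2, form, hadd, hscal, alpha2; cbn [cL c1 c2 cd].
  f_equal; ring. }
assert (Ht : forall a b c d, t_ ((- (1 / 2)) *: alpha2)%H (Hvec a b c d) =
    Hvec a b (c - a / 2) (d + a / 4 + b / 2 - c)).
{ intros a b c d; unfold t_, form, hadd, hscal, alpha2, delta;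
    cbn [cL c1 c2 cd].
  f_equal; field; auto. }
assert (Hp : forall x y s, point tau (zvec x y) s =
    let c := 2 * PI * Ci in
    Hvec (- (c * tau)) (- (c * (x - y))) (- (c * x)) (c * s)).
{ intros x y s; unfold point, zvec, hadd, hscal, Lambda0, alpha3, alpha1, alpha2,
    delta; cbn [cL c1 c2 cd].
  generalize (2 * PI * Ci); intro c; cbv zeta.
  f_equal; field; auto. }
rewrite !Hp; cbv zeta; rewrite Ht, Hr.
generalize (2 * PI * Ci); intro c.
f_equal; field; auto.
Qed.

Definition num_Lddot_coord (s : sign) (sec : sector) (M m m2 : Z) (ty : heart)
    (k1 k2 : Z) : C -> C -> C -> C -> C :=
  let f tau z1 z2 t := num_Lddot s M m m2 ty k1 k2 tau (zvec z1 z2) t in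
  match sec with untwisted => f | twisted => twist f end.

(** * N=4 and N=2 characters *)

Definition theta_sector (s : sign) (sec : sector) : C -> C -> C :=
  match sec, s with
  | untwisted, Plus => theta 0 0
  | untwisted, Minus => theta 0 1
  | twisted, Plus => theta 1 0
  | twisted, Minus => theta 1 1
  end.

Definition R_N4 (s : sign) (sec : sector) (tau z : C) : C :=
  - sgn s * Ci * (eta tau ^ 3 * theta 1 1 tau (2 * z) / theta_sector s sec tau z ^ 2).

(* Reduction of the direct sum of L(Lambda_adm M m m2 ty k1 k2) and
   L(Lambda_adm M m (m2+1) ty k1 k2) *)
Definition ch_Hddot_N4 (s : sign) (sec : sector) (M m m2 : Z) (ty : heart)
    (k1 k2 : Z) (tau z : C) : C :=
  num_Lddot_coord s sec M m m2 ty k1 k2 tau (z + tau / 2) (z - tau / 2) (tau / 4)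
  / R_N4 s sec tau z.

(* Coordinates on Lambda_0, alpha_1, alpha_2, delta of sl(2|1)^.  The N=2
   characters are indexed by the parameters of this weight. *)
Definition lambda_sl21 (M m' m2 k1 k2 : Z) : hvec :=
  let K := (m' + 1) / M - 1 in
  Hvec K
       (- ((K + 1) * (k2 - m2 / (K + 1))))
       (- ((K + 1) * k1))
       (- ((K + 1) * k1 * (k2 - m2 / (K + 1)))).

(* Reduction of L(lambda_sl21 M m' m2 k1 k2), untwisted or Ramond twisted *)
Definition ch_H_N2 (s : sign) (sec : sector) (M m' m2 k1 k2 : Z) (tau z : C) : C :=
  let c := match s with Plus => RtoC (powerRZ (-1) m2) | Minus => 1 end in
  let eps := match s with Plus => (1 / 2)%R | Minus => 0%R end in
  let j := match sec with untwisted => (IZR k1 + 1 / 2)%R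
                        | twisted => (IZR k1 + 1)%R end in
  let k := match sec with untwisted => (IZR k2 + 1 / 2)%R
                        | twisted => IZR k2 end in
  c * Psi M (IZR (m' + 1)) (IZR (- m2)) eps j k tau z (- z) 0
  * theta_sector s sec tau z / eta tau ^ 3.

(** * Index sets and products *)

Definition Omega (ty : heart) (M k1 k2 : Z) : Prop :=
  (0 <= k1 /\
   match ty with typeI => 0 <= k2 | typeIII => 1 <= k2 end /\
   2 * k1 + k2 <= M - 2)%Z.

Definition Dprod (tau z : C) : C :=
  Cprod (fun n => (1 - e2pi (2 * z) * qpow tau (INR n - 1))
                  * (1 - e2pi (- (2 * z)) * qpow tau (INR n))).

(* Main.v *)
Require Import Defs.
From Stdlib Require Import Lia Lra.

(** Both sides of each identity are one and the same Appell-Lerch sum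
    [Psi], multiplied by different theta quotients.

    On the side of the superalgebra, the numerator of the module with parameters
    [(m, p)] is an alternating pair of sums over [j] of Gaussian terms with the double
    denominator [(1 +- X_j)^2], where [X_j = e2pi (x - j tau)].  Replacing [p]
    by [p + 1] multiplies the [j]-th numerator by [X_j^(-1)], so in the direct sum of
    the modules for [m2] and [m2 + 1] one factor of the denominator cancels
    ([F_summand_add]).  What remains is, after [j -> - j], a sum [Phi1]; its image
    under [r_theta] is the corresponding [Phi2], so the whole numerator is a
    [Phi] ([num_L_add_Phi]).  The affine translation in the principal admissible
    weight turns [Phi] into [Psi] ([num_Lddot_Psi]), and evaluating at the point
    prescribed by the reduction moves the two indices of [Psi] by [(1/2, 1/2)]
    in the untwisted and by [(1, 0)] in the twisted sector ([Psi_shift]).  This is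
    exactly the [Psi] of the N=2 character, at [z] or at [-z].

    Dividing by the two denominators, the ratio of the N=4 to the N=2
    character is [i theta_ab (tau, z) / theta_11 (tau, 2 z)] up to the parity
    sign of [theta_ab].  Jacobi's triple product identity writes both theta
    functions as Euler's product times the products of the statement, and
    Euler's product cancels since it is not zero ([theta_ratio]).

    The triple product itself ([jacobi_triple_product]) is obtained from its
    finite form, a symmetric rewriting of the q-binomial theorem, by letting
    the number of factors grow.  The q-binomial coefficients are bounded and tend to the
    inverse of Euler's product, so Tannery's theorem applies ([tannery]). *)

(** * Exponentials and inverses of complex numbers *)

Ltac numeral_neq0 :=
  let H := fresh in intro H; apply RtoC_inj, eq_IZR in H; discriminate H.

Ltac Cfield := field; repeat split; try assumption; try numeral_neq0.

Lemma Cexp_plus x y : Cexp (x + y) = Cexp x * Cexp y.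
Proof.
unfold Cexp, Cmult, Re, Im; simpl.
rewrite exp_plus, cos_plus, sin_plus; f_equal; ring.
Qed.

Lemma Cmod_Cexp x : Cmod (Cexp x) = exp (Re x).
Proof.
unfold Cmod, Cexp, fst, snd.
pose proof (sin2_cos2 (Im x)) as H; unfold Rsqr in *.
replace ((exp (Re x) * cos (Im x)) ^ 2 + (exp (Re x) * sin (Im x)) ^ 2)%R
  with ((exp (Re x))²)%R.
- apply sqrt_Rsqr; left; apply exp_pos.
- unfold Rsqr; rewrite <- (Rmult_1_r (_ * _)), <- H; ring.
Qed.

Lemma e2pi_plus x y : e2pi (x + y) = e2pi x * e2pi y.
Proof.
unfold e2pi; rewrite <- Cexp_plus; f_equal; ring.
Qed.

Lemma e2pi_Z (n : Z) : e2pi n = 1.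
Proof.
unfold e2pi, Cexp.
replace (2 * PI * Ci * n) with (0, 2 * (IZR n * PI))%R
  by (unfold ZtoC, RtoC, Ci, Cmult; simpl; f_equal; ring).
unfold Re, Im; simpl.
rewrite exp_0, cos_2a_sin, sin_2a.
rewrite (sin_eq_0_1 (IZR n * PI)) by (exists n; reflexivity).
unfold RtoC; f_equal; ring.
Qed.

Lemma e2pi_0 : e2pi 0 = 1.
Proof. exact (e2pi_Z 0). Qed.

Lemma e2pi_half : e2pi (1 / 2) = - (1).
Proof.
unfold e2pi, Cexp.
replace (2 * PI * Ci * (1 / 2)) with (PI * Ci) by Cfield.
replace (PI * Ci) with (0, PI)%R
  by (unfold RtoC, Ci, Cmult; simpl; f_equal; ring).
unfold Re, Im; simpl.
rewrite exp_0, cos_PI, sin_PI.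
unfold RtoC, Copp; simpl; f_equal; ring.
Qed.

Lemma e2pi_quarter : e2pi (1 / 4) = Ci.
Proof.
unfold e2pi, Cexp.
replace (2 * PI * Ci * (1 / 4)) with (RtoC (PI / 2) * Ci)
  by (rewrite RtoC_div by lra; Cfield).
replace (RtoC (PI / 2) * Ci) with (0, PI / 2)%R
  by (unfold RtoC, Ci, Cmult; simpl; f_equal; ring).
unfold Re, Im; simpl.
rewrite exp_0, cos_PI2, sin_PI2.
unfold Ci; f_equal; ring.
Qed.

Lemma e2pi_neq0 x : e2pi x <> 0.
Proof.
intro H; apply C1_nz.
rewrite <- e2pi_0, <- (Cplus_opp_r x), e2pi_plus, H; ring.
Qed.

Lemma e2pi_opp x : e2pi (- x) = / e2pi x.
Proof.
assert (H : e2pi x * e2pi (- x) = 1)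
  by (rewrite <- e2pi_plus, Cplus_opp_r; apply e2pi_0).
rewrite <- (Cmult_1_r (/ e2pi x)), <- H; field; apply e2pi_neq0.
Qed.

Lemma Cmod_e2pi x : Cmod (e2pi x) = exp (- (2 * PI) * Im x).
Proof.
unfold e2pi; rewrite Cmod_Cexp; f_equal.
unfold Re, Im, RtoC, Ci, Cmult; simpl; ring.
Qed.

Lemma e2pi_add_half w : e2pi (w + 1 / 2) = - e2pi w.
Proof. rewrite e2pi_plus, e2pi_half; ring. Qed.

Lemma e2pi_sub_half w : e2pi (w - 1 / 2) = - e2pi w.
Proof.
replace (w - 1 / 2) with (w + (-1)%Z + 1 / 2) by (unfold ZtoC; Cfield).
rewrite e2pi_add_half, e2pi_plus, e2pi_Z; ring.
Qed.

Lemma Cinv_0 : / RtoC 0 = 0.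
Proof.
unfold Cinv, RtoC; simpl; f_equal; unfold Rdiv; ring.
Qed.

(** As [/ 0 = 0], inversion is multiplicative without side condition. *)
Lemma Cinv_mult x y : / (x * y) = / x * / y.
Proof.
destruct (Ceq_dec x 0) as [->|hx].
{ rewrite Cmult_0_l, Cinv_0; ring. }
destruct (Ceq_dec y 0) as [->|hy].
{ rewrite Cmult_0_r, Cinv_0; ring. }
field; auto.
Qed.

Lemma Cinv_involutive x : / / x = x.
Proof.
destruct (Ceq_dec x 0) as [->|hx].
{ now rewrite !Cinv_0. }
field; auto.
Qed.

Lemma Cmod_inv_total x : Cmod (/ x) = (/ Cmod x)%R.
Proof.
destruct (Ceq_dec x 0) as [->|hx].
{ now rewrite Cinv_0, Cmod_0, Rinv_0. }
now apply Cmod_inv.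
Qed.

Lemma ZtoC_plus a b : ZtoC (a + b) = ZtoC a + ZtoC b.
Proof. unfold ZtoC; now rewrite plus_IZR, RtoC_plus. Qed.
Lemma ZtoC_opp a : ZtoC (- a) = - ZtoC a.
Proof. unfold ZtoC; now rewrite opp_IZR, RtoC_opp. Qed.
Lemma ZtoC_minus a b : ZtoC (a - b) = ZtoC a - ZtoC b.
Proof. unfold ZtoC; now rewrite minus_IZR, RtoC_minus. Qed.
Lemma ZtoC_nat n : ZtoC (Z.of_nat n) = RtoC (INR n).
Proof. unfold ZtoC; now rewrite INR_IZR_INZ. Qed.

(** * Absolutely convergent series indexed by naturals and integers *)

Lemma im_le_Cmod c : (Rabs (Im c) <= Cmod c)%R.
Proof. eapply Rle_trans; [apply Rmax_r | apply Rmax_Cmod]. Qed.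

Lemma im_plus x y : Im (x + y) = (Im x + Im y)%R. Proof. reflexivity. Qed.

Lemma C_ext (x y : C) : Re x = Re y -> Im x = Im y -> x = y.
Proof. destruct x, y; simpl; intros; now f_equal. Qed.

Definition abs_summable (u : nat -> C) : Prop := ex_series (fun n => Cmod (u n)).

Lemma abs_summable_le u (b : nat -> R) :
  (forall n, (Cmod (u n) <= b n)%R) -> ex_series b -> abs_summable u.
Proof.
intros H; apply (ex_series_le (K := R_AbsRing) (V := R_CompleteNormedModule)).
intro n; unfold norm; simpl; unfold abs; simpl.
rewrite Rabs_pos_eq; [apply H | apply Cmod_ge_0].
Qed.

Lemma ex_series_Re u : abs_summable u -> ex_series (fun n => Re (u n)).
Proof.
apply (ex_series_le (K := R_AbsRing) (V := R_CompleteNormedModule)).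
intro; apply re_le_Cmod.
Qed.

Lemma ex_series_Im u : abs_summable u -> ex_series (fun n => Im (u n)).
Proof.
apply (ex_series_le (K := R_AbsRing) (V := R_CompleteNormedModule)).
intro; apply im_le_Cmod.
Qed.

Lemma ex_series_Rmult_l (c : R) (a : nat -> R) :
  ex_series a -> ex_series (fun n => c * a n)%R.
Proof. exact (ex_series_scal_l (K := R_AbsRing) c a). Qed.

Lemma CSeries_ext u v : (forall n, u n = v n) -> CSeries u = CSeries v.
Proof.
intro H; unfold CSeries; f_equal; apply Series_ext; intro n; now rewrite H.
Qed.

(** [CSeries] sums real and imaginary parts separately, so even multiplication
    by a complex scalar mixes two real series and needs both to converge;
    absolute convergence is the hypothesis that serves every rule below. *)
Lemma CSeries_plus u v : abs_summable u -> abs_summable v ->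
  CSeries (fun n => u n + v n) = CSeries u + CSeries v.
Proof.
intros hu hv; unfold CSeries; apply C_ext; simpl;
  apply Series_plus; auto using ex_series_Re, ex_series_Im.
Qed.

Lemma CSeries_scal c u : abs_summable u ->
  CSeries (fun n => c * u n) = c * CSeries u.
Proof.
intros hu; pose proof (ex_series_Re _ hu); pose proof (ex_series_Im _ hu).
unfold CSeries; apply C_ext; simpl.
- rewrite Series_minus; [now rewrite !Series_scal_l|..].
  + now apply (ex_series_Rmult_l (Re c) (fun n => Re (u n))).
  + now apply (ex_series_Rmult_l (Im c) (fun n => Im (u n))).
- rewrite Series_plus; [now rewrite !Series_scal_l|..].
  + now apply (ex_series_Rmult_l (Re c) (fun n => Im (u n))).
  + now apply (ex_series_Rmult_l (Im c) (fun n => Re (u n))).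
Qed.

Lemma CSeries_incr_1 u : abs_summable u ->
  CSeries u = u O + CSeries (fun n => u (S n)).
Proof.
intros hu; unfold CSeries; apply C_ext; simpl; apply Series_incr_1;
  auto using ex_series_Re, ex_series_Im.
Qed.

Definition abs_summableZ (f : Z -> C) : Prop :=
  abs_summable (fun n => f (Z.of_nat n)) /\
  abs_summable (fun n => f (- Z.of_nat (S n))%Z).

Lemma sumZ_ext f g : (forall j, f j = g j) -> sumZ f = sumZ g.
Proof.
intro H; unfold sumZ; f_equal; apply CSeries_ext; intro; apply H.
Qed.

Lemma sumZ_plus f g : abs_summableZ f -> abs_summableZ g ->
  sumZ (fun j => f j + g j) = sumZ f + sumZ g.
Proof.
intros [f1 f2] [g1 g2]; unfold sumZ.
rewrite (CSeries_plus _ _ f1 g1), (CSeries_plus _ _ f2 g2); ring.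
Qed.

Lemma sumZ_scal c f : abs_summableZ f -> sumZ (fun j => c * f j) = c * sumZ f.
Proof.
intros [f1 f2]; unfold sumZ.
rewrite (CSeries_scal c _ f1), (CSeries_scal c _ f2); ring.
Qed.

Lemma sumZ_opp f : abs_summableZ f -> sumZ (fun j => f (- j)%Z) = sumZ f.
Proof.
intros [f1 f2]; unfold sumZ.
assert (g1 : abs_summable (fun n => f (- Z.of_nat n)%Z)).
{ unfold abs_summable; now rewrite ex_series_incr_1. }
rewrite (CSeries_incr_1 _ f1), (CSeries_incr_1 _ g1).
rewrite (CSeries_ext (fun n => f (- - Z.of_nat (S n))%Z)
           (fun n => f (Z.of_nat (S n)))) by (intro; f_equal; lia).
simpl; ring.
Qed.

Lemma abs_summableZ_opp f :
  abs_summableZ f -> abs_summableZ (fun j => f (- j)%Z).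
Proof.
intros [f1 f2]; split; unfold abs_summable.
- now apply (ex_series_incr_1 (fun n => Cmod (f (- Z.of_nat n)%Z))).
- apply (ex_series_ext (fun n => Cmod (f (Z.of_nat (S n))))).
  { intro n; do 2 f_equal; lia. }
  now apply (ex_series_incr_1 (fun n => Cmod (f (Z.of_nat n)))).
Qed.

Lemma abs_summableZ_scal c f :
  abs_summableZ f -> abs_summableZ (fun j => c * f j).
Proof.
intros [f1 f2]; split; unfold abs_summable.
- apply (ex_series_ext (fun n => Cmod c * Cmod (f (Z.of_nat n)))%R);
    [intro; now rewrite Cmod_mult|].
  now apply (ex_series_Rmult_l (Cmod c)).
- apply (ex_series_ext (fun n => Cmod c * Cmod (f (- Z.of_nat (S n))%Z))%R);
    [intro; now rewrite Cmod_mult|].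
  now apply (ex_series_Rmult_l (Cmod c)).
Qed.

Lemma sumZ_neg f : sumZ (fun j => - f j) = - sumZ f.
Proof.
assert (H : forall u, CSeries (fun n => - u n) = - CSeries u)
  by (intro u; unfold CSeries; apply C_ext; simpl; apply Series_opp).
unfold sumZ; rewrite (H (fun n => f (Z.of_nat n))), (H (fun n => f (- Z.of_nat (S n))%Z)).
ring.
Qed.

(** This substitution exchanges the two halves of [sumZ] term by term, so it
    holds whether or not the series converge. *)
Lemma sumZ_reflect f : sumZ (fun j => f (- j - 1)%Z) = sumZ f.
Proof.
unfold sumZ; rewrite Cplus_comm; f_equal; apply CSeries_ext; intro; f_equal; lia.
Qed.

(** Completing the square bounds a Gaussian by a geometric sequence. *)
Lemma ex_series_gauss (a b c : R) : (0 < a)%R ->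
  ex_series (fun n => exp (- a * INR n ^ 2 + b * INR n + c)).
Proof.
intro ha; set (K := exp (c + (b + 1) ^ 2 / (4 * a))).
apply (ex_series_le (K := R_AbsRing) (V := R_CompleteNormedModule) _
         (fun n => K * exp (-1) ^ n)%R).
- intro n; unfold norm; simpl; unfold abs; simpl.
  rewrite Rabs_pos_eq by (left; apply exp_pos).
  replace (exp (-1) ^ n)%R with (exp (- INR n)).
  2: { induction n as [|n IH]; [now simpl; rewrite Ropp_0, exp_0|].
       rewrite S_INR; simpl; rewrite <- IH, <- exp_plus; f_equal; ring. }
  unfold K; rewrite <- exp_plus.
  assert (H : (- a * (INR n * (INR n * 1)) + b * INR n + c <=
               c + (b + 1) ^ 2 / (4 * a) + - INR n)%R).
  { assert (E : (c + (b + 1) ^ 2 / (4 * a) + - INR n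
                 - (- a * (INR n * (INR n * 1)) + b * INR n + c)
                 = a * (INR n - (b + 1) / (2 * a)) ^ 2)%R) by (field; lra).
    assert (0 <= a * (INR n - (b + 1) / (2 * a)) ^ 2)%R
      by (apply Rmult_le_pos; [lra | apply pow2_ge_0]).
    lra. }
  destruct H as [H|H]; [left; now apply exp_increasing | right; now rewrite H].
- apply (ex_series_Rmult_l K (fun n => exp (-1) ^ n)%R), ex_series_geom.
  rewrite Rabs_pos_eq by (left; apply exp_pos).
  rewrite <- exp_0; apply exp_increasing; lra.
Qed.

(** The bound is only asked for [|j|] large, because the sums at hand have
    finitely many terms near a small denominator. *)
Lemma abs_summableZ_gauss (f : Z -> C) (a b c : R) (J : nat) : (0 < a)%R ->
  (forall j, (Z.of_nat J <= Z.abs j)%Z ->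
     (Cmod (f j) <= exp (- a * IZR j ^ 2 + b * Rabs (IZR j) + c))%R) ->
  abs_summableZ f.
Proof.
intros ha H.
set (g := fun n : nat => exp (- a * INR n ^ 2 + b * INR n + c)).
assert (hg : ex_series g) by now apply ex_series_gauss.
assert (D : forall (n : nat) j, Z.abs j = Z.of_nat n -> (J <= n)%nat ->
              (Cmod (f j) <= g n)%R).
{ intros n j hj hn; unfold g; rewrite INR_IZR_INZ, <- hj.
  eapply Rle_trans; [apply H; lia|].
  rewrite abs_IZR, <- pow2_abs; apply Rle_refl. }
split; unfold abs_summable.
- apply (ex_series_incr_n _ J).
  apply (abs_summable_le (fun n => f (Z.of_nat (J + n))) (fun n => g (J + n)%nat));
    [|now apply (ex_series_incr_n g J)].
  intro n; apply D; lia.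
- apply (ex_series_incr_n _ J).
  apply (abs_summable_le (fun n => f (- Z.of_nat (S (J + n)))%Z)
           (fun n => g (S J + n)%nat));
    [|now apply (ex_series_incr_n g (S J))].
  intro n; apply D; lia.
Qed.

(** * Limits of complex sequences and Tannery's theorem *)

Definition Clim (u : nat -> C) (l : C) : Prop :=
  is_lim_seq (fun n => Re (u n)) (Re l) /\ is_lim_seq (fun n => Im (u n)) (Im l).

Lemma Clim_ext_loc u v l :
  (exists N, forall n, (N <= n)%nat -> u n = v n) -> Clim u l -> Clim v l.
Proof.
intros [N H] [h1 h2]; split.
- apply (is_lim_seq_ext_loc (fun n => Re (u n))); [|exact h1].
  exists N; intros; now rewrite H.
- apply (is_lim_seq_ext_loc (fun n => Im (u n))); [|exact h2].
  exists N; intros; now rewrite H.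
Qed.

Lemma Clim_const c : Clim (fun _ => c) c.
Proof. split; apply is_lim_seq_const. Qed.

Lemma Clim_plus u v a b : Clim u a -> Clim v b -> Clim (fun n => u n + v n) (a + b).
Proof.
intros [h1 h2] [h3 h4]; split; simpl; now apply is_lim_seq_plus'.
Qed.

Lemma Clim_mult u v a b : Clim u a -> Clim v b -> Clim (fun n => u n * v n) (a * b).
Proof.
intros [h1 h2] [h3 h4]; split; simpl.
- apply is_lim_seq_minus'; now apply is_lim_seq_mult'.
- apply is_lim_seq_plus'; now apply is_lim_seq_mult'.
Qed.

Lemma Clim_inv u (a : C) : a <> 0 -> Clim u a -> Clim (fun n => / u n) (/ a).
Proof.
intros ha [h1 h2].
assert (hn : (fst a ^ 2 + snd a ^ 2 <> 0)%R).
{ intro H; apply ha, C_ext; unfold Re, Im; simpl; nra. }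
assert (hd : is_lim_seq (fun n => (fst (u n) ^ 2 + snd (u n) ^ 2)%R)
                        (fst a ^ 2 + snd a ^ 2)%R).
{ apply is_lim_seq_plus'; simpl.
  - apply is_lim_seq_mult'; [exact h1|].
    apply is_lim_seq_mult'; [exact h1|apply is_lim_seq_const].
  - apply is_lim_seq_mult'; [exact h2|].
    apply is_lim_seq_mult'; [exact h2|apply is_lim_seq_const]. }
split; unfold Re, Im, Cinv, fst at 1, snd at 1.
- now apply is_lim_seq_div'.
- apply is_lim_seq_div'; [|exact hd|exact hn].
  now apply (is_lim_seq_opp _ (Im a)).
Qed.

Lemma Clim_subseq u l (phi : nat -> nat) :
  filterlim phi eventually eventually -> Clim u l -> Clim (fun n => u (phi n)) l.
Proof.
intros F [h1 h2].
split; [apply (filterlim_comp _ _ _ phi (fun n => Re (u n)) _ _ _ F h1)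
       |apply (filterlim_comp _ _ _ phi (fun n => Im (u n)) _ _ _ F h2)].
Qed.

Lemma Clim_incr_1 u l : Clim (fun n => u (S n)) l -> Clim u l.
Proof.
intros [h1 h2].
split; [apply (is_lim_seq_incr_1 (fun n => Re (u n)))
       |apply (is_lim_seq_incr_1 (fun n => Im (u n)))]; assumption.
Qed.

Lemma Cprod_eq f l : Clim (Cprod_upto f) l -> Cprod f = l.
Proof.
intros [h1 h2]; unfold Cprod; apply C_ext; simpl.
- now rewrite (is_lim_seq_unique _ _ h1).
- now rewrite (is_lim_seq_unique _ _ h2).
Qed.

Lemma Cprod_ext f g : (forall n, f n = g n) -> Cprod f = Cprod g.
Proof.
intro H.
assert (E : forall N, Cprod_upto f N = Cprod_upto g N).
{ induction N as [|N IH]; [reflexivity|]; simpl; now rewrite IH, H. }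
unfold Cprod; f_equal; f_equal; apply Lim_seq_ext; intro; now rewrite E.
Qed.

(** A sequence whose increments are absolutely summable converges. *)
Lemma ex_Clim_increments u :
  abs_summable (fun n => u (S n) - u n) -> exists l, Clim u l.
Proof.
intros h.
assert (T : forall v : nat -> R, ex_series (fun n => v (S n) - v n)%R ->
            exists l : R, is_lim_seq v l).
{ intros v [s hs]; exists (s + v O)%R.
  apply (is_lim_seq_incr_1 v).
  apply (is_lim_seq_ext (fun n => sum_n (fun k => v (S k) - v k) n + v O)%R).
  - induction n as [|n IH]; [rewrite sum_O; ring|].
    rewrite sum_Sn; unfold plus; simpl.
    replace (sum_n (fun k => v (S k) - v k)%R n + (v (S (S n)) - v (S n)) + v O)%R
      with (sum_n (fun k => v (S k) - v k)%R n + v O + (v (S (S n)) - v (S n)))%R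
      by ring.
    rewrite IH; ring.
  - apply is_lim_seq_plus'; [exact hs | apply is_lim_seq_const]. }
destruct (T (fun n => Re (u n)) (ex_series_Re _ h)) as [a ha].
destruct (T (fun n => Im (u n)) (ex_series_Im _ h)) as [b hb].
now exists (a, b).
Qed.

Fixpoint Csum (f : nat -> C) (n : nat) : C :=
  match n with O => 0 | S k => Csum f k + f k end.

Lemma Csum_ext f g n : (forall k, (k < n)%nat -> f k = g k) -> Csum f n = Csum g n.
Proof.
induction n as [|n IH]; intros H; simpl; [reflexivity|].
rewrite IH, H; auto.
Qed.

Lemma Csum_plus f g n : Csum (fun k => f k + g k) n = Csum f n + Csum g n.
Proof. induction n as [|n IH]; simpl; [ring | rewrite IH; ring]. Qed.

Lemma Csum_scal c f n : Csum (fun k => c * f k) n = c * Csum f n.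
Proof. induction n as [|n IH]; simpl; [ring | rewrite IH; ring]. Qed.

Lemma Csum_incr_1 f n : Csum f (S n) = f O + Csum (fun k => f (S k)) n.
Proof.
induction n as [|n IH]; [simpl; ring|].
change (Csum f (S (S n))) with (Csum f (S n) + f (S n)).
rewrite IH; simpl; ring.
Qed.

(** Cutting a sum of [p + n] terms at [p] and reading the first part backwards;
    with [p] the centre, the two parts are the two halves of a bilateral sum. *)
Lemma Csum_split f p n :
  Csum f (p + n) = Csum (fun k => f (p + k)%nat) n + Csum (fun k => f (p - S k)%nat) p.
Proof.
revert f; induction p as [|p IH]; intro f; [simpl; now rewrite Cplus_0_r|].
change (S p + n)%nat with (S (p + n)); rewrite Csum_incr_1, IH; simpl.
rewrite Nat.sub_diag.
rewrite (Csum_ext (fun k => f (S (p - S k))) (fun k => f (p - k)%nat))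
  by (intros k hk; f_equal; lia).
ring.
Qed.

(** Tannery's theorem: uniform domination lets a limit pass under a sum with a
    growing number of terms.  The head of the sum converges termwise, and the
    tails of all the sums are bounded by the tail of the dominating series. *)
Lemma tannery_R (a : nat -> nat -> R) (l b : nat -> R) :
  (forall k, is_lim_seq (fun n => a n k) (l k)) ->
  (forall n k, (Rabs (a n k) <= b k)%R) -> ex_series b ->
  is_lim_seq (fun n => sum_n (a n) n) (Series l).
Proof.
intros hlim hb exb.
assert (hl : forall k, (Rabs (l k) <= b k)%R).
{ intro k.
  refine (is_lim_seq_le (fun n => Rabs (a n k)) (fun _ => b k)
            (Rabs (l k)) (b k) _ _ (is_lim_seq_const _)).
  - intro; apply hb.
  - now apply (is_lim_seq_abs _ (l k)). }
assert (exl : ex_series l)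
  by (apply (ex_series_le (K := R_AbsRing) (V := R_CompleteNormedModule) _ b); auto).
apply is_lim_seq_spec; intro eps.
assert (he : (0 < eps / 8)%R) by (destruct eps; simpl; lra).
assert (sb : is_lim_seq (sum_n b) (Series b)) by exact (Series_correct _ exb).
apply is_lim_seq_spec in sb; destruct (sb (mkposreal _ he)) as [K hK].
specialize (hK K (Nat.le_refl _)) as hK0; simpl in hK, hK0.
assert (tail : forall (u : nat -> R) n, (forall k, (Rabs (u k) <= b k)%R) -> (K <= n)%nat ->
  (Rabs (sum_n u n - sum_n u K) <= eps / 4)%R).
{ intros u n hu hn.
  destruct (Nat.eq_dec K n) as [->|hne].
  { rewrite Rminus_diag, Rabs_R0; lra. }
  assert (E : forall v : nat -> R, (sum_n v n - sum_n v K = sum_n_m v (S K) n)%R).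
  { intro v; symmetry; apply (sum_n_m_sum_n (G := R_AbelianGroup) v K n); lia. }
  rewrite E.
  eapply Rle_trans; [apply (norm_sum_n_m (K := R_AbsRing) (V := R_NormedModule) u)|].
  eapply Rle_trans; [apply (sum_n_m_le _ b); exact hu|].
  rewrite <- E.
  specialize (hK n hn).
  apply Rabs_def2 in hK; apply Rabs_def2 in hK0; lra. }
assert (lims : is_lim_seq (fun n => sum_n (a n) K) (sum_n l K)).
{ clear - hlim; induction K as [|K IH].
  - apply (is_lim_seq_ext (fun n => a n O)); [intro; now rewrite sum_O|].
    rewrite sum_O; apply hlim.
  - apply (is_lim_seq_ext (fun n => sum_n (a n) K + a n (S K))%R);
      [intro; now rewrite sum_Sn|].
    rewrite sum_Sn; now apply is_lim_seq_plus'. }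
apply is_lim_seq_spec in lims; destruct (lims (mkposreal _ he)) as [N hN].
simpl in hN.
assert (tl : (Rabs (Series l - sum_n l K) <= eps / 4)%R).
{ refine (is_lim_seq_le (fun n => Rabs (sum_n l (K + n) - sum_n l K)) (fun _ => (eps / 4)%R)
            (Rabs (Series l - sum_n l K)) (eps / 4)%R _ _ (is_lim_seq_const _)).
  - intro n; apply tail; [exact hl | lia].
  - apply (is_lim_seq_abs _ (Series l - sum_n l K)%R).
    apply is_lim_seq_minus'; [|apply is_lim_seq_const].
    apply (is_lim_seq_ext (fun n => sum_n l (n + K))); [intro; now rewrite Nat.add_comm|].
    apply (is_lim_seq_incr_n (sum_n l) K), (Series_correct _ exl). }
exists (max N K); intros n hn.
specialize (hN n ltac:(lia)).
assert (ta : (Rabs (sum_n (a n) n - sum_n (a n) K) <= eps / 4)%R)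
  by (apply tail; [apply hb | lia]).
apply Rabs_def2 in hN.
apply Rabs_le_between in ta; apply Rabs_le_between in tl.
apply Rabs_def1; destruct eps; simpl in *; lra.
Qed.

Lemma tannery (a : nat -> nat -> C) (l : nat -> C) (b : nat -> R) :
  (forall k, Clim (fun n => a n k) (l k)) ->
  (forall n k, (Cmod (a n k) <= b k)%R) -> ex_series b ->
  Clim (fun n => Csum (a n) (S n)) (CSeries l).
Proof.
intros hlim hb exb; split.
- change (is_lim_seq (fun n => Re (Csum (a n) (S n))) (Series (fun k => Re (l k)))).
  apply (is_lim_seq_ext (fun n => sum_n (fun k => Re (a n k)) n)).
  { intro n; generalize (a n); intro f; clear.
    induction n as [|n IH]; [rewrite sum_O; simpl; now rewrite Rplus_0_l|].
    rewrite sum_Sn, IH; reflexivity. }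
  apply (tannery_R _ _ b); [intro; apply hlim | | exact exb].
  intros; eapply Rle_trans; [apply re_le_Cmod | apply hb].
- change (is_lim_seq (fun n => Im (Csum (a n) (S n))) (Series (fun k => Im (l k)))).
  apply (is_lim_seq_ext (fun n => sum_n (fun k => Im (a n k)) n)).
  { intro n; generalize (a n); intro f; clear.
    induction n as [|n IH]; [rewrite sum_O; simpl; now rewrite Rplus_0_l|].
    rewrite sum_Sn, IH; reflexivity. }
  apply (tannery_R _ _ b); [intro; apply hlim | | exact exb].
  intros; eapply Rle_trans; [apply im_le_Cmod | apply hb].
Qed.


(** * The finite products (q; q)_n *)

Lemma qpow_plus tau a b : qpow tau (a + b) = qpow tau a * qpow tau b.
Proof. unfold qpow; rewrite <- e2pi_plus; f_equal; ring. Qed.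

Lemma qpow_0 tau : qpow tau 0 = 1.
Proof. unfold qpow; rewrite Cmult_0_l; apply e2pi_0. Qed.

Definition qabs (tau : C) : R := exp (- (2 * PI) * Im tau).

Lemma qabs_bounds tau : (0 < Im tau)%R -> (0 < qabs tau < 1)%R.
Proof.
intro h; unfold qabs; split; [apply exp_pos|].
rewrite <- exp_0; apply exp_increasing.
pose proof PI_RGT_0; nra.
Qed.

Lemma Cmod_qpow_nat tau n : Cmod (qpow tau (INR n)) = (qabs tau ^ n)%R.
Proof.
unfold qpow, qabs; rewrite Cmod_e2pi.
induction n as [|n IH].
- replace (Im (INR 0 * tau)) with 0%R by (unfold Im; simpl; ring).
  rewrite Rmult_0_r; apply exp_0.
- replace (Im (INR (S n) * tau)) with (Im tau + Im (INR n * tau))%R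
    by (rewrite S_INR; unfold Im; simpl; ring).
  rewrite Rmult_plus_distr_l, exp_plus, IH; reflexivity.
Qed.

Definition qfact (tau : C) (n : nat) : C :=
  Cprod_upto (fun n => 1 - qpow tau (INR n)) n.

Lemma qabs_pow_le tau n : (0 < Im tau)%R -> (0 < qabs tau ^ S n <= qabs tau)%R.
Proof.
intro h; destruct (qabs_bounds tau h) as [r0 r1]; split; [now apply pow_lt|].
induction n as [|n IH]; [simpl; lra|].
change (qabs tau ^ S (S n))%R with (qabs tau * qabs tau ^ S n)%R.
assert (0 < qabs tau ^ S n)%R by (now apply pow_lt); nra.
Qed.

Lemma exp_ge_1_plus x : (1 + x <= exp x)%R.
Proof.
destruct (Req_dec x 0) as [->|h]; [rewrite exp_0; lra|].
left; now apply exp_ineq1.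
Qed.

Lemma exp_le x y : (x <= y)%R -> (exp x <= exp y)%R.
Proof.
intros [h| ->]; [left; now apply exp_increasing | apply Rle_refl].
Qed.

(** [|1 - x| <= exp |x|], and the sum of [r^k] over [1 <= k <= n] has the closed
    form [r (1 - r^n) / (1 - r)], which carries the induction. *)
Lemma qfact_upper tau n : (0 < Im tau)%R ->
  (Cmod (qfact tau n) <= exp (qabs tau / (1 - qabs tau)))%R.
Proof.
intro h; destruct (qabs_bounds tau h) as [r0 r1]; set (r := qabs tau) in *.
assert (H : (Cmod (qfact tau n) <= exp (r * (1 - r ^ n) / (1 - r)))%R).
{ induction n as [|n IH].
  - unfold qfact; simpl; rewrite Cmod_1, Rminus_diag, Rmult_0_r.
    unfold Rdiv; rewrite Rmult_0_l, exp_0; lra.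
  - change (qfact tau (S n)) with (qfact tau n * (1 - qpow tau (INR (S n)))).
    rewrite Cmod_mult.
    replace (r * (1 - r ^ S n) / (1 - r))%R
      with (r * (1 - r ^ n) / (1 - r) + r ^ S n)%R by (simpl; field; lra).
    rewrite exp_plus.
    apply Rmult_le_compat; try apply Cmod_ge_0; [exact IH|].
    eapply Rle_trans; [apply Cmod_triangle|].
    rewrite Cmod_1, Cmod_opp, Cmod_qpow_nat; apply exp_ge_1_plus. }
eapply Rle_trans; [exact H|].
apply exp_le, Rmult_le_compat_r; [left; apply Rinv_0_lt_compat; lra|].
assert (0 < r ^ n)%R by now apply pow_lt.
nra.
Qed.

(** From [1 - x >= exp (- x / (1 - x)) >= exp (- x / (1 - r))] for
    [0 < x <= r], summed as in [qfact_upper]. *)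
Lemma qfact_lower tau n : (0 < Im tau)%R ->
  (exp (- (qabs tau / (1 - qabs tau) / (1 - qabs tau))) <= Cmod (qfact tau n))%R.
Proof.
intro h; destruct (qabs_bounds tau h) as [r0 r1].
assert (hp := fun n => qabs_pow_le tau n h); set (r := qabs tau) in *.
assert (H : (exp (- (r * (1 - r ^ n) / (1 - r) / (1 - r))) <= Cmod (qfact tau n))%R).
{ induction n as [|n IH].
  - unfold qfact; simpl; rewrite Cmod_1, Rminus_diag, Rmult_0_r.
    unfold Rdiv; rewrite !Rmult_0_l, Ropp_0, exp_0; lra.
  - change (qfact tau (S n)) with (qfact tau n * (1 - qpow tau (INR (S n)))).
    rewrite Cmod_mult.
    replace (- (r * (1 - r ^ S n) / (1 - r) / (1 - r)))%R
      with (- (r * (1 - r ^ n) / (1 - r) / (1 - r)) + - (r ^ S n / (1 - r)))%R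
      by (simpl; field; lra).
    rewrite exp_plus.
    apply Rmult_le_compat; try (left; apply exp_pos); [exact IH|].
    destruct (hp n) as [p0 p1]; set (x := (r ^ S n)%R) in *.
    apply Rle_trans with (1 - x)%R.
    + rewrite exp_Ropp, <- (Rinv_inv (1 - x)).
      apply Rinv_le_contravar; [apply Rinv_0_lt_compat; lra|].
      apply Rle_trans with (1 + x / (1 - r))%R; [|apply exp_ge_1_plus].
      apply Rmult_le_reg_r with ((1 - x) * (1 - r))%R; [apply Rmult_lt_0_compat; lra|].
      replace (/ (1 - x) * ((1 - x) * (1 - r)))%R with (1 - r)%R by (field; lra).
      replace ((1 + x / (1 - r)) * ((1 - x) * (1 - r)))%R
        with ((1 - r) + x * (r - x))%R by (field; lra).
      nra.
    + pose proof (Cmod_triangle (1 - qpow tau (INR (S n))) (qpow tau (INR (S n)))) as T.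
      replace (1 - qpow tau (INR (S n)) + qpow tau (INR (S n))) with (RtoC 1) in T by ring.
      rewrite Cmod_1, Cmod_qpow_nat in T; fold r in T; fold x in T; lra. }
eapply Rle_trans; [|exact H].
apply exp_le, Ropp_le_contravar.
apply Rmult_le_compat_r; [left; apply Rinv_0_lt_compat; lra|].
apply Rmult_le_compat_r; [left; apply Rinv_0_lt_compat; lra|].
assert (0 < r ^ n)%R by now apply pow_lt.
nra.
Qed.

Lemma qfact_neq0 tau n : (0 < Im tau)%R -> qfact tau n <> 0.
Proof.
intros h H; pose proof (qfact_lower tau n h) as L.
rewrite H, Cmod_0 in L.
pose proof (exp_pos (- (qabs tau / (1 - qabs tau) / (1 - qabs tau)))); lra.
Qed.

(** Euler's product (q; q)_oo converges, and the uniform lower bound on the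
    partial products keeps its value away from 0. *)
Lemma qfact_lim tau : (0 < Im tau)%R ->
  exists E : C, E <> 0 /\ Clim (qfact tau) E.
Proof.
intro h; destruct (qabs_bounds tau h) as [r0 r1].
destruct (ex_Clim_increments (qfact tau)) as [E hE].
{ apply abs_summable_le with
    (b := fun n => (exp (qabs tau / (1 - qabs tau)) * qabs tau * qabs tau ^ n)%R).
  - intro n.
    change (qfact tau (S n)) with (qfact tau n * (1 - qpow tau (INR (S n)))).
    replace (qfact tau n * (1 - qpow tau (INR (S n))) - qfact tau n)
      with (- (qfact tau n * qpow tau (INR (S n)))) by ring.
    rewrite Cmod_opp, Cmod_mult, Cmod_qpow_nat, Rmult_assoc.
    apply Rmult_le_compat_r; [|now apply qfact_upper].
    left; now apply (pow_lt _ (S n)).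
  - apply (ex_series_Rmult_l _ (fun n => qabs tau ^ n)%R), ex_series_geom.
    rewrite Rabs_pos_eq; lra. }
exists E; split; [intros ->|exact hE].
set (c := exp (- (qabs tau / (1 - qabs tau) / (1 - qabs tau)))).
destruct hE as [h1 h2].
pose proof (is_lim_seq_abs _ _ h1) as a1; pose proof (is_lim_seq_abs _ _ h2) as a2.
pose proof (is_lim_seq_plus' _ _ _ _ a1 a2) as a3.
assert (L : Rbar_le c (Rabs (Re 0) + Rabs (Im 0))%R).
{ refine (is_lim_seq_le (fun _ => c) _ c _ _ (is_lim_seq_const _) a3).
  intro n; eapply Rle_trans; [now apply qfact_lower|].
  assert (S : forall x : C, (Cmod x <= Rabs (Re x) + Rabs (Im x))%R).
  { intro x; replace x with (RtoC (Re x) + Ci * RtoC (Im x)) at 1.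
    - eapply Rle_trans; [apply Cmod_triangle|].
      rewrite Cmod_mult, !Cmod_R, Cmod_Ci; lra.
    - apply C_ext; unfold Re, Im; simpl; ring. }
  apply S. }
simpl in L; unfold Re, Im in L; simpl in L; rewrite Rabs_R0 in L.
pose proof (exp_pos (- (qabs tau / (1 - qabs tau) / (1 - qabs tau)))).
unfold c in L; lra.
Qed.

(** * The Jacobi triple product *)

(** Pascal's rule rather than a quotient of q-factorials, so that the
    coefficient vanishes for [k > n] and is defined without division. *)
Fixpoint qbin (tau : C) (n k : nat) : C :=
  match n, k with
  | _, O => 1
  | O, S _ => 0
  | S n', S k' => qbin tau n' (S k') + qpow tau (INR (n' - k')) * qbin tau n' k'
  end.

Lemma qbin_0_r tau n : qbin tau n 0 = 1.
Proof. now destruct n. Qed.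

Lemma qbin_gt tau n k : (n < k)%nat -> qbin tau n k = 0.
Proof.
revert k; induction n as [|n IH]; intros [|k] hk; try lia; [reflexivity|].
simpl; rewrite !IH by lia; ring.
Qed.

(** Pascal's rule matches the identity
    [1 - q^(k+l) = (1 - q^l) + q^l (1 - q^k)]. *)
Lemma qbin_qfact tau k l :
  qbin tau (k + l) k * (qfact tau k * qfact tau l) = qfact tau (k + l).
Proof.
remember (k + l)%nat as n eqn:hn; revert k l hn.
induction n as [|n IH]; intros [|k] [|l] hn; try lia.
- unfold qfact; simpl; ring.
- rewrite qbin_0_r; simpl in hn; rewrite <- hn; unfold qfact at 1; simpl; ring.
- assert (n = k) by lia; subst k.
  simpl; rewrite qbin_gt, Nat.sub_diag by lia.
  pose proof (IH n O ltac:(lia)) as E.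
  change (qfact tau (S n)) with (qfact tau n * (1 - qpow tau (INR (S n)))).
  rewrite <- E at 2; change (INR 0) with 0%R; rewrite qpow_0; ring.
- pose proof (IH k (S l) ltac:(lia)) as E1.
  pose proof (IH (S k) l ltac:(lia)) as E2.
  simpl qbin; replace (n - k)%nat with (S l) by lia.
  change (qfact tau (S n)) with (qfact tau n * (1 - qpow tau (INR (S n)))).
  replace (qpow tau (INR (S n))) with (qpow tau (INR (S l)) * qpow tau (INR (S k))).
  2: { rewrite <- qpow_plus, <- RtoC_plus, <- plus_INR; do 3 f_equal; lia. }
  transitivity (qfact tau n * (1 - qpow tau (INR (S l)))
    + qpow tau (INR (S l)) * qfact tau n * (1 - qpow tau (INR (S k)))); [|ring].
  rewrite <- E2 at 1; rewrite <- E1.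
  change (qfact tau (S k)) with (qfact tau k * (1 - qpow tau (INR (S k)))).
  change (qfact tau (S l)) with (qfact tau l * (1 - qpow tau (INR (S l)))).
  ring.
Qed.

(** The general term [q^(x(x-1)/2) y^x], with [y = e2pi w], of the theta series
    that the products [(1 + y q^(n-1)) (1 + y^(-1) q^n)] expand into.  The index
    [x] is a complex number so that it can be a natural number or an integer. *)
Definition theta_term (tau w x : C) : C := e2pi (x * (x - 1) / 2 * tau + x * w).

Fixpoint qshift_prod (tau w : C) (n : nat) : C :=
  match n with
  | O => 1
  | S k => qshift_prod tau w k * (1 + e2pi (w + INR k * tau))
  end.

(** The new factor [1 + y q^n] acts on coefficients by Pascal's rule, as
    [q^n y] times the [k]-th term is [q^(n-k)] times the [(k+1)]-st. *)
Lemma q_binomial_theorem tau w n :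
  qshift_prod tau w n = Csum (fun k => qbin tau n k * theta_term tau w (INR k)) (S n).
Proof.
induction n as [|n IH].
- simpl; unfold theta_term.
  replace (0 * (0 - 1) / 2 * tau + 0 * w) with (RtoC 0) by Cfield.
  rewrite e2pi_0; ring.
- set (a := fun k => theta_term tau w (INR k)).
  change (qshift_prod tau w n = Csum (fun k => qbin tau n k * a k) (S n)) in IH.
  change (qshift_prod tau w (S n) = Csum (fun k => qbin tau (S n) k * a k) (S (S n))).
  rewrite Csum_incr_1.
  rewrite (Csum_ext _ (fun k => qbin tau n (S k) * a (S k)
             + e2pi (w + INR n * tau) * (qbin tau n k * a k))).
  + rewrite Csum_plus, Csum_scal, <- IH.
    assert (E : a O + Csum (fun k => qbin tau n (S k) * a (S k)) (S n) =
                qshift_prod tau w n).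
    { pose proof (Csum_incr_1 (fun k => qbin tau n k * a k) (S n)) as E.
      cbv beta in E; rewrite qbin_0_r, Cmult_1_l in E; rewrite <- E.
      change (Csum (fun k => qbin tau n k * a k) (S (S n))) with
        (Csum (fun k => qbin tau n k * a k) (S n) + qbin tau n (S n) * a (S n)).
      rewrite qbin_gt, <- IH by lia; ring. }
    rewrite qbin_0_r, Cplus_assoc, Cmult_1_l, E; simpl; ring.
  + intros k hk; simpl qbin.
    rewrite Cmult_plus_distr_r; f_equal.
    transitivity (qbin tau n k * (qpow tau (INR (n - k)) * a (S k))); [ring|].
    transitivity (qbin tau n k * (e2pi (w + INR n * tau) * a k)); [|ring].
    f_equal; unfold qpow, a, theta_term; rewrite <- !e2pi_plus; f_equal.
    rewrite minus_INR, S_INR, RtoC_minus, RtoC_plus by lia; Cfield.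
Qed.

Definition jacobi_factor (tau w : C) (n : nat) : C :=
  (1 + e2pi w * qpow tau (INR n - 1)) * (1 + e2pi (- w) * qpow tau (INR n)).

Lemma qshift_prod_incr_l tau w n :
  qshift_prod tau w (S n) = (1 + e2pi w) * qshift_prod tau (w + tau) n.
Proof.
induction n as [|n IH].
- simpl; rewrite Cmult_0_l, Cplus_0_r; ring.
- change (qshift_prod tau w (S (S n))) with
    (qshift_prod tau w (S n) * (1 + e2pi (w + INR (S n) * tau))).
  rewrite IH; simpl qshift_prod; rewrite S_INR, RtoC_plus.
  replace (w + tau + INR n * tau) with (w + (INR n + 1) * tau) by ring; ring.
Qed.

(** Each factor [1 + y q^(-n)] of the centred product equals
    [y q^(-n) (1 + y^(-1) q^n)]; the monomials collect into the exponential. *)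
Lemma jacobi_prod_qshift tau w N :
  qshift_prod tau (w - INR N * tau) (N + N) =
  e2pi (INR N * w - INR N * (INR N + 1) / 2 * tau)
  * Cprod_upto (jacobi_factor tau w) N.
Proof.
induction N as [|N IH].
- simpl. replace (0 * w - 0 * (0 + 1) / 2 * tau) with (RtoC 0) by Cfield.
  rewrite e2pi_0; ring.
- replace (S N + S N)%nat with (S (S (N + N))) by lia.
  change (qshift_prod tau (w - INR (S N) * tau) (S (S (N + N)))) with
    (qshift_prod tau (w - INR (S N) * tau) (S (N + N))
     * (1 + e2pi (w - INR (S N) * tau + INR (S (N + N)) * tau))).
  rewrite qshift_prod_incr_l.
  rewrite !S_INR, plus_INR, !RtoC_plus.
  replace (w - (INR N + 1) * tau + tau) with (w - INR N * tau) by ring.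
  rewrite IH; simpl Cprod_upto.
  generalize (Cprod_upto (jacobi_factor tau w) N); intro P; unfold jacobi_factor.
  rewrite !S_INR, !RtoC_plus; unfold qpow.
  replace (w - (INR N + 1) * tau + (INR N + INR N + 1) * tau)
    with (w + INR N * tau) by ring.
  replace ((INR N + 1 - 1) * tau) with (INR N * tau) by ring.
  rewrite <- (e2pi_plus w), <- (e2pi_plus (- w)).
  replace ((INR N + 1) * w - (INR N + 1) * (INR N + 1 + 1) / 2 * tau)
    with ((INR N * w - INR N * (INR N + 1) / 2 * tau) + (w - (INR N + 1) * tau))
    by Cfield.
  rewrite (e2pi_plus (_ - _) (w - _)).
  replace (- w + (INR N + 1) * tau) with (- (w - (INR N + 1) * tau)) by ring.
  rewrite (e2pi_opp (w - (INR N + 1) * tau)).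
  field; apply e2pi_neq0.
Qed.

(** The q-binomial theorem for [2 N] factors starting at [y q^(-N)]: the term of
    index [N + j] is the theta term of index [j], up to the monomial of
    [jacobi_prod_qshift]. *)
Lemma finite_jacobi tau w N :
  Cprod_upto (jacobi_factor tau w) N =
  Csum (fun n => qbin tau (N + N) (N + n) * theta_term tau w (Z.of_nat n)) (S N)
  + Csum (fun n => qbin tau (N + N) (N - S n)
                   * theta_term tau w (- Z.of_nat (S n))%Z) N.
Proof.
pose proof (jacobi_prod_qshift tau w N) as E.
rewrite q_binomial_theorem in E.
replace (S (N + N)) with (N + S N)%nat in E by lia.
rewrite Csum_split in E.
set (c := e2pi (INR N * w - INR N * (INR N + 1) / 2 * tau)) in E.
assert (T : forall j : Z, forall k : nat, Z.of_nat k = (Z.of_nat N + j)%Z ->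
   theta_term tau (w - INR N * tau) (INR k) = c * theta_term tau w j).
{ intros j k hk.
  rewrite <- (ZtoC_nat k), hk, ZtoC_plus, ZtoC_nat.
  unfold c, theta_term; rewrite <- e2pi_plus; f_equal; Cfield. }
rewrite (Csum_ext _ (fun n => c *
  (qbin tau (N + N) (N + n) * theta_term tau w (Z.of_nat n)))) in E
  by (intros k hk; rewrite (T (Z.of_nat k)) by lia; ring).
rewrite (Csum_ext (fun n => qbin tau (N + N) (N - S n) * _) (fun n => c *
  (qbin tau (N + N) (N - S n) * theta_term tau w (- Z.of_nat (S n))%Z))) in E
  by (intros k hk; rewrite (T (- Z.of_nat (S k))%Z) by lia; ring).
rewrite !Csum_scal in E.
assert (hc : c <> 0) by apply e2pi_neq0.
apply (f_equal (fun x => / c * x)) in E.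
rewrite Cmult_plus_distr_l, !Cmult_assoc, Cinv_l, !Cmult_1_l in E by exact hc.
now symmetry.
Qed.

Lemma theta_term_summable tau w : (0 < Im tau)%R ->
  abs_summableZ (fun j => theta_term tau w j).
Proof.
intro h.
apply (abs_summableZ_gauss _ (PI * Im tau) (PI * Im tau + 2 * PI * Rabs (Im w)) 0 0).
{ pose proof PI_RGT_0; nra. }
intros j _; unfold theta_term; rewrite Cmod_e2pi; apply exp_le.
replace (j * (j - 1) / 2) with (RtoC (IZR j * (IZR j - 1) / 2))
  by (unfold ZtoC; rewrite RtoC_div, RtoC_mult, RtoC_minus by lra; reflexivity).
unfold ZtoC; rewrite im_plus, !im_scal_l.
pose proof PI_RGT_0 as hpi.
set (x := IZR j); set (y := Im w); set (t := Im tau) in *.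
pose proof (Rle_abs x); pose proof (Rle_abs (- (x * y))).
rewrite Rabs_Ropp, Rabs_mult in H0.
assert (PI * t * x <= PI * t * Rabs x)%R
  by (apply Rmult_le_compat_l; [nra | assumption]).
assert (2 * PI * - (x * y) <= 2 * PI * (Rabs x * Rabs y))%R
  by (apply Rmult_le_compat_l; lra).
replace (- (2 * PI) * (x * (x - 1) / 2 * t + x * y))%R
  with (- (PI * t) * x ^ 2 + PI * t * x + 2 * PI * - (x * y))%R by field.
nra.
Qed.

Lemma qbin_eq tau k l : (0 < Im tau)%R ->
  qbin tau (k + l) k = qfact tau (k + l) * / (qfact tau k * qfact tau l).
Proof.
intro h; rewrite <- qbin_qfact; field; split; now apply qfact_neq0.
Qed.

Lemma qbin_bounded tau : (0 < Im tau)%R ->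
  exists B, forall n k, (Cmod (qbin tau n k) <= B)%R.
Proof.
intro h.
set (u := exp (qabs tau / (1 - qabs tau))).
set (c := exp (- (qabs tau / (1 - qabs tau) / (1 - qabs tau)))).
assert (hc : (0 < c)%R) by apply exp_pos.
assert (hu : (0 < u)%R) by apply exp_pos.
exists (u * (/ c * / c))%R; intros n k.
destruct (Nat.le_gt_cases k n) as [hk|hk].
- replace n with (k + (n - k))%nat by lia.
  rewrite (qbin_eq _ _ _ h), Cmod_mult, Cmod_inv_total, Cmod_mult, Rinv_mult.
  assert (L : forall m, (0 <= / Cmod (qfact tau m) <= / c)%R).
  { intro m; pose proof (qfact_lower tau m h) as L; fold c in L.
    split; [left; apply Rinv_0_lt_compat; lra | now apply Rinv_le_contravar]. }
  apply Rmult_le_compat; [apply Cmod_ge_0 | | now apply qfact_upper |].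
  + apply Rmult_le_pos; apply L.
  + apply Rmult_le_compat; apply L.
- rewrite qbin_gt, Cmod_0 by exact hk.
  assert (0 < / c)%R by now apply Rinv_0_lt_compat.
  apply Rmult_le_pos; [lra | apply Rmult_le_pos; lra].
Qed.

Lemma qbin_central_lim tau k (E : C) : (0 < Im tau)%R -> E <> 0 -> Clim (qfact tau) E ->
  Clim (fun n => qbin tau (n + n) (n + k)) (/ E) /\
  Clim (fun n => qbin tau (n + n) (n - k)) (/ E).
Proof.
intros h hE hlim.
assert (L : Clim (fun n => qfact tau (n + n)
                   * / (qfact tau (n + k) * qfact tau (n - k))) (/ E)).
{ replace (/ E) with (E * / (E * E)) by (field; exact hE).
  apply Clim_mult; [|apply Clim_inv; [now apply Cmult_neq_0 | apply Clim_mult]];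
    apply (Clim_subseq (qfact tau)); try exact hlim;
    intros P [N HN]; exists (N + k)%nat; intros; apply HN; lia. }
split; (eapply Clim_ext_loc; [|exact L]); exists k; intros n hn; cbv beta.
- replace (n + n)%nat with ((n + k) + (n - k))%nat by lia.
  now rewrite qbin_eq.
- replace (n + n)%nat with ((n - k) + (n + k))%nat by lia.
  rewrite qbin_eq by exact h; now rewrite (Cmult_comm (qfact tau (n - k))).
Qed.

Definition euler_prod (tau : C) : C := Cprod (fun n => 1 - qpow tau (INR n)).

(** Jacobi's identity is the limit of its finite form: every coefficient tends to
    [1 / (q; q)_oo], boundedly, and the theta series is absolutely convergent. *)
Theorem jacobi_triple_product tau w : (0 < Im tau)%R ->
  euler_prod tau <> 0 /\
  sumZ (fun j => theta_term tau w j) =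
    euler_prod tau * Cprod (jacobi_factor tau w).
Proof.
intro h; destruct (qfact_lim tau h) as [E [hE hlim]].
assert (EE : euler_prod tau = E) by (now apply Cprod_eq).
rewrite EE; split; [exact hE|].
destruct (qbin_bounded tau h) as [B hB].
destruct (theta_term_summable tau w h) as [s1 s2].
assert (L : Clim (Cprod_upto (jacobi_factor tau w))
              (/ E * sumZ (fun j => theta_term tau w j))).
{ unfold sumZ; rewrite Cmult_plus_distr_l, <- !CSeries_scal by assumption.
  apply (Clim_ext_loc _ _ _ (ex_intro _ O (fun n _ => eq_sym (finite_jacobi tau w n)))).
  apply Clim_plus.
  - apply (tannery (fun n k => qbin tau (n + n) (n + k) * theta_term tau w (Z.of_nat k))
             _ (fun k => B * Cmod (theta_term tau w (Z.of_nat k)))%R).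
    + intro k; apply Clim_mult; [|apply Clim_const].
      now apply qbin_central_lim.
    + intros n k; rewrite Cmod_mult; apply Rmult_le_compat_r; [apply Cmod_ge_0 | apply hB].
    + now apply (ex_series_Rmult_l B
                   (fun k => Cmod (theta_term tau w (Z.of_nat k)))).
  (* The negative half has N terms, one fewer than [tannery] provides for. *)
  - apply Clim_incr_1.
    apply (tannery (fun n k => qbin tau (S n + S n) (S n - S k)
                               * theta_term tau w (- Z.of_nat (S k))%Z)
             _ (fun k => B * Cmod (theta_term tau w (- Z.of_nat (S k))%Z))%R).
    + intro k; apply Clim_mult; [|apply Clim_const].
      apply (Clim_subseq (fun n => qbin tau (n + n) (n - S k)) _ S).
      * intros P [N HN]; exists N; intros; apply HN; lia.
      * now apply qbin_central_lim.
    + intros n k; rewrite Cmod_mult; apply Rmult_le_compat_r; [apply Cmod_ge_0 | apply hB].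
    + now apply (ex_series_Rmult_l B
                   (fun k => Cmod (theta_term tau w (- Z.of_nat (S k))%Z))). }
rewrite (Cprod_eq _ _ L); field; exact hE.
Qed.

(** * The four theta functions as products *)

Lemma theta_0_prod b tau z : (0 < Im tau)%R ->
  theta 0 b tau z =
  euler_prod tau * Cprod (jacobi_factor tau (z + b / 2 + tau / 2)).
Proof.
intro h; rewrite <- (proj2 (jacobi_triple_product tau _ h)).
apply sumZ_ext; intro n; unfold theta_term, e2pi; f_equal.
change (ZtoC 0) with (RtoC 0); Cfield.
Qed.

(** At [-z], the substitution [n -> - n] brings the series to the normal form of
    [theta_term]; at [z] it would
    give the product with the roles of [e2pi z] and [e2pi (- z)] exchanged. *)
Lemma theta_1_prod b tau z : (0 < Im tau)%R ->
  theta 1 b tau (- z) =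
  e2pi (tau / 8 - z / 2 + b / 4)
  * (euler_prod tau * Cprod (jacobi_factor tau (z - b / 2))).
Proof.
intro h; rewrite <- (proj2 (jacobi_triple_product tau _ h)).
pose proof (theta_term_summable tau (z - b / 2) h) as S.
rewrite <- (sumZ_opp _ S), <- sumZ_scal.
- apply sumZ_ext; intro n; unfold theta_term; rewrite <- e2pi_plus.
  unfold e2pi; f_equal; rewrite ZtoC_opp; change (ZtoC 1) with (RtoC 1); Cfield.
- now apply (abs_summableZ_opp (fun j => theta_term tau (z - b / 2) j)).
Qed.

(** The substitution [n -> - n - 1] negates [n + 1/2]. *)
Lemma theta_10_opp tau z : theta 1 0 tau (- z) = theta 1 0 tau z.
Proof.
unfold theta; rewrite <- sumZ_reflect; apply sumZ_ext; intro n.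
f_equal; rewrite ZtoC_minus, ZtoC_opp.
change (ZtoC 1) with (RtoC 1); change (ZtoC 0) with (RtoC 0); Cfield.
Qed.

(** As for [theta_10_opp], but the shift of the argument by [1/2] leaves the
    factor [e2pi (- (n + 1/2)) = -1]. *)
Lemma theta_11_opp tau z : theta 1 1 tau (- z) = - theta 1 1 tau z.
Proof.
unfold theta; rewrite <- sumZ_reflect, <- sumZ_neg; apply sumZ_ext; intro n.
transitivity (e2pi (- n - 1 / 2)
  * Cexp (PI * Ci * (n + 1 / 2) ^ 2 * tau + 2 * PI * Ci * (n + 1 / 2) * (z + 1 / 2))).
- unfold e2pi; rewrite <- Cexp_plus; f_equal.
  rewrite ZtoC_minus, ZtoC_opp; change (ZtoC 1) with (RtoC 1); Cfield.
- change (ZtoC 1) with (RtoC 1).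
  replace (- n - 1 / 2) with (ZtoC (- n - 1) + 1 / 2)
    by (rewrite ZtoC_minus, ZtoC_opp; change (ZtoC 1) with (RtoC 1); Cfield).
  rewrite e2pi_plus, e2pi_Z, e2pi_half; ring.
Qed.

Definition theta_numerator (s : sign) (sec : sector) (tau z : C) : C :=
  match sec with
  | untwisted =>
      Cprod (fun n => (1 + sgn s * e2pi z * qpow tau (INR n - 1 / 2))
                      * (1 + sgn s * e2pi (- z) * qpow tau (INR n - 1 / 2)))
  | twisted =>
      Cprod (fun n => (1 + sgn s * e2pi z * qpow tau (INR n - 1))
                      * (1 + sgn s * e2pi (- z) * qpow tau (INR n)))
  end.

Definition theta_phase (s : sign) (sec : sector) (tau z : C) : C :=
  match sec, s with
  | untwisted, _ => 1
  | twisted, Plus => e2pi (tau / 8 - z / 2)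
  | twisted, Minus => - Ci * e2pi (tau / 8 - z / 2)
  end.

Lemma theta_sector_prod s sec tau z : (0 < Im tau)%R ->
  theta_sector s sec tau z =
  theta_phase s sec tau z * (euler_prod tau * theta_numerator s sec tau z).
Proof.
intro h.
assert (P : forall w c, (forall n, jacobi_factor tau w n = c n) ->
              Cprod (jacobi_factor tau w) = Cprod c)
  by (intros; now apply Cprod_ext).
destruct sec, s; simpl theta_sector; unfold theta_phase, theta_numerator, sgn.
- rewrite theta_0_prod, Cmult_1_l by exact h; f_equal; apply P; intro n.
  unfold jacobi_factor, qpow; rewrite <- !e2pi_plus, !Cmult_1_l, <- !e2pi_plus.
  change (ZtoC 0) with (RtoC 0); f_equal; f_equal; f_equal; Cfield.
- rewrite theta_0_prod, Cmult_1_l by exact h; f_equal; apply P; intro n.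
  unfold jacobi_factor, qpow; change (ZtoC 1) with (RtoC 1).
  replace (z + 1 / 2 + tau / 2) with (z + tau / 2 + 1 / 2) by Cfield.
  replace (- (z + tau / 2 + 1 / 2)) with (- (z + tau / 2) - 1 / 2) by Cfield.
  rewrite e2pi_add_half, e2pi_sub_half.
  transitivity ((1 - e2pi (z + tau / 2) * e2pi ((INR n - 1) * tau))
                * (1 - e2pi (- (z + tau / 2)) * e2pi (INR n * tau))); [ring|].
  transitivity ((1 - e2pi z * e2pi ((INR n - 1 / 2) * tau))
                * (1 - e2pi (- z) * e2pi ((INR n - 1 / 2) * tau))); [|ring].
  rewrite <- !e2pi_plus; f_equal; f_equal; f_equal; Cfield.
- rewrite <- theta_10_opp, theta_1_prod by exact h.
  change (ZtoC 0) with (RtoC 0).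
  replace (tau / 8 - z / 2 + 0 / 4) with (tau / 8 - z / 2) by Cfield.
  do 2 f_equal; apply P; intro n; unfold jacobi_factor.
  replace (z - 0 / 2) with z by Cfield; ring.
- replace (theta 1 1 tau z) with (- theta 1 1 tau (- z))
    by (rewrite theta_11_opp; ring).
  rewrite theta_1_prod by exact h; change (ZtoC 1) with (RtoC 1).
  rewrite e2pi_plus, e2pi_quarter.
  rewrite (P _ (fun n => (1 + - (1) * e2pi z * qpow tau (INR n - 1))
                         * (1 + - (1) * e2pi (- z) * qpow tau (INR n)))); [ring|].
  intro n; unfold jacobi_factor.
  replace (- (z - 1 / 2)) with (- z + 1 / 2) by ring.
  rewrite e2pi_add_half, e2pi_sub_half; ring.
Qed.

Lemma theta_11_double tau z : (0 < Im tau)%R ->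
  theta 1 1 tau (2 * z) =
  - Ci * e2pi (tau / 8 - z) * (euler_prod tau * Dprod tau z).
Proof.
intro h; pose proof (theta_sector_prod Minus twisted tau (2 * z) h) as E.
simpl theta_sector in E; rewrite E; unfold theta_phase, theta_numerator.
replace (2 * z / 2) with z by Cfield.
do 2 f_equal; apply Cprod_ext; intro n; simpl sgn; ring.
Qed.

Lemma theta_sector_parity s sec tau z : (0 < Im tau)%R ->
  theta_sector s sec tau (- z) =
  match sec, s with twisted, Minus => - (1) | _, _ => 1 end * theta_sector s sec tau z.
Proof.
intro h; destruct sec.
- replace (match s with Plus => _ | Minus => _ end) with (RtoC 1) by now destruct s.
  assert (H : forall w, theta_phase s untwisted tau w = 1) by now destruct s.
  rewrite Cmult_1_l, !theta_sector_prod, !H by exact h; do 2 f_equal.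
  unfold theta_numerator; apply Cprod_ext; intro n.
  replace (- - z) with z by ring; ring.
- destruct s; simpl theta_sector; [rewrite theta_10_opp | rewrite theta_11_opp]; ring.
Qed.

(** * Numerators of the affine superalgebra in coordinates *)

Lemma point_coords tau x y t : point tau (zvec x y) t =
  let c := 2 * PI * Ci in
  Hvec (- (c * tau)) (- (c * (x - y))) (- (c * x)) (c * t).
Proof.
unfold point, zvec, hadd, hscal, Lambda0, alpha3, alpha1, alpha2, delta;
  cbn [cL c1 c2 cd].
generalize (2 * PI * Ci); intro c; cbv zeta; f_equal; Cfield.
Qed.

Lemma translate_theta_point (j : C) tau x y t :
  t_ ((- j) *: theta_root)%H (point tau (zvec x y) t) =
  point tau (zvec (x - j * tau) (y + j * tau)) (t + j ^ 2 * tau + j * (y - x)).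
Proof.
rewrite !point_coords; cbv zeta; generalize (2 * PI * Ci); intro c.
unfold t_, form, theta_root, hadd, hscal, alpha3, alpha1, alpha2, delta;
  cbn [cL c1 c2 cd].
f_equal; Cfield.
Qed.

Lemma r_theta_point tau x y t :
  r_theta (point tau (zvec x y) t) = point tau (zvec y x) t.
Proof.
rewrite !point_coords; cbv zeta; generalize (2 * PI * Ci); intro c.
unfold r_theta, form, theta_root, hadd, hscal, alpha3, alpha1, alpha2;
  cbn [cL c1 c2 cd].
f_equal; ring.
Qed.

Lemma hexp_Lambda_rho (m p : Z) tau x y t :
  hexp (Lambda m p + rho)%H (point tau (zvec x y) t) = e2pi (m * t - (p - 1) * x).
Proof.
rewrite point_coords; unfold hexp, e2pi; f_equal; cbv zeta.
generalize (2 * PI * Ci); intro c.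
unfold form, Lambda, rho, hadd, hscal, Lambda0, alpha3, alpha1; cbn [cL c1 c2 cd].
Cfield.
Qed.

Lemma hexp_opp_alpha1 tau x y t :
  hexp ((-1) *: alpha1)%H (point tau (zvec x y) t) = e2pi x.
Proof.
rewrite point_coords; unfold hexp, e2pi; f_equal; cbv zeta.
generalize (2 * PI * Ci); intro c.
unfold form, hscal, alpha1; cbn [cL c1 c2 cd]; ring.
Qed.

(** The summand of [F_num] for [Lambda m p], with the exponent sorted by powers
    of [j] to exhibit the Gaussian. *)
Definition F_summand (s : sign) (m p : Z) (tau x y t : C) (j : Z) : C :=
  e2pi (m * j ^ 2 * tau + j * (m * (y - x) + (p - 1) * tau) + (m * t - (p - 1) * x))
  * (/ (1 + sgn s * e2pi (x - j * tau)) * / (1 + sgn s * e2pi (x - j * tau))).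

Lemma F_num_point s m p tau x y t :
  F_num s m p (point tau (zvec x y) t) = sumZ (F_summand s m p tau x y t).
Proof.
unfold F_num; apply sumZ_ext; intro j; unfold act.
rewrite translate_theta_point, hexp_Lambda_rho.
unfold alpha3; rewrite hexp_opp_alpha1.
unfold Cdiv; rewrite Cinv_mult; unfold F_summand; f_equal.
f_equal; ring.
Qed.

(** * Convergence of the numerators *)

Lemma Cmod_inv_1_plus (y : C) : (Cmod y <= 1 / 2 \/ 2 <= Cmod y)%R ->
  (Cmod (/ (1 + y)) <= 2)%R.
Proof.
intro h; rewrite Cmod_inv_total.
assert (H : (1 / 2 <= Cmod (1 + y))%R).
{ destruct h as [h|h].
  - pose proof (Cmod_triangle (1 + y) (- y)) as T.
    replace (1 + y + - y) with (RtoC 1) in T by ring.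
    rewrite Cmod_1, Cmod_opp in T; lra.
  - pose proof (Cmod_triangle (1 + y) (- (1))) as T.
    replace (1 + y + - (1)) with y in T by ring.
    rewrite Cmod_m1 in T; lra. }
replace 2%R with (/ (1 / 2))%R by field.
apply Rinv_le_contravar; lra.
Qed.

(** [|e2pi (x - j tau)|] tends to 0 or to infinity exponentially as [j] tends to
    either end, so only finitely many denominators can be small. *)
Lemma denominator_bounded s tau x : (0 < Im tau)%R ->
  exists J : nat, forall j : Z, (Z.of_nat J <= Z.abs j)%Z ->
    (Cmod (/ (1 + sgn s * e2pi (x - j * tau))) <= 2)%R.
Proof.
intro h; pose proof PI_RGT_0 as hpi.
destruct (INR_unbounded ((Rabs (Im x) + 1) / Im tau)) as [J hJ].
exists J; intros j hj; apply Cmod_inv_1_plus.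
assert (hs : Cmod (sgn s) = 1%R)
  by (destruct s; simpl; [apply Cmod_1 | apply Cmod_m1]).
rewrite Cmod_mult, hs, Rmult_1_l, Cmod_e2pi.
replace (Im (x - j * tau)) with (Im x - IZR j * Im tau)%R
  by (unfold ZtoC, Cminus; rewrite im_plus; unfold Im; simpl; ring).
assert (hx := Rle_abs (Im x)); assert (hx' := Rle_abs (- Im x)); rewrite Rabs_Ropp in hx'.
assert (hJ' : (Rabs (Im x) + 1 < INR J * Im tau)%R).
{ apply (Rmult_lt_compat_r (Im tau)) in hJ; [|exact h].
  unfold Rdiv in hJ; rewrite Rmult_assoc, Rinv_l, Rmult_1_r in hJ by lra; exact hJ. }
rewrite INR_IZR_INZ in hJ'.
assert (e1 : (2 <= exp 1)%R) by (pose proof (exp_ge_1_plus 1); lra).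
pose proof PI2_1.
apply IZR_le in hj; destruct (Z.abs_spec j) as [[h0 e]|[h0 e]]; rewrite e in hj.
- right; apply Rle_trans with (1 := e1), exp_le.
  assert (IZR (Z.of_nat J) * Im tau <= IZR j * Im tau)%R
    by (apply Rmult_le_compat_r; lra).
  unfold PI2 in *; nra.
- left; apply Rle_trans with (exp (- (1))).
  + apply exp_le.
    rewrite opp_IZR in hj.
    assert (IZR (Z.of_nat J) * Im tau <= - IZR j * Im tau)%R
      by (apply Rmult_le_compat_r; lra).
    unfold PI2 in *; nra.
  + rewrite exp_Ropp; unfold Rdiv; rewrite Rmult_1_l; apply Rinv_le_contravar; lra.
Qed.

Lemma gauss_summable (m : R) tau u v (g : Z -> C) (B : R) (J : nat) :
  (0 < m)%R -> (0 < Im tau)%R -> (0 < B)%R ->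
  (forall j, (Z.of_nat J <= Z.abs j)%Z -> (Cmod (g j) <= B)%R) ->
  abs_summableZ (fun j => e2pi (m * j ^ 2 * tau + j * u + v) * g j).
Proof.
intros hm h hB hg; pose proof PI_RGT_0 as hpi.
apply (abs_summableZ_gauss _ (2 * PI * (m * Im tau)) (2 * PI * Rabs (Im u))
         (- (2 * PI) * Im v + ln B) J).
{ apply Rmult_lt_0_compat; nra. }
intros j hj; rewrite Cmod_mult, Cmod_e2pi.
replace (Im (m * j ^ 2 * tau + j * u + v))
  with (m * IZR j ^ 2 * Im tau + IZR j * Im u + Im v)%R.
2: { unfold ZtoC; rewrite !im_plus, <- RtoC_pow, <- RtoC_mult, !im_scal_l; reflexivity. }
rewrite <- Rplus_assoc, exp_plus, exp_ln by exact hB.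
apply Rmult_le_compat; [left; apply exp_pos | apply Cmod_ge_0 | | now apply hg].
apply exp_le.
pose proof (Rle_abs (- (IZR j * Im u))) as A; rewrite Rabs_Ropp, Rabs_mult in A.
apply (Rmult_le_compat_l (2 * PI)) in A; lra.
Qed.

Lemma F_summand_summable s m p tau x y t : (0 < m)%Z -> (0 < Im tau)%R ->
  abs_summableZ (F_summand s m p tau x y t).
Proof.
intros hm h; destruct (denominator_bounded s tau x h) as [J hJ].
apply (gauss_summable (IZR m) tau (m * (y - x) + (p - 1) * tau) (m * t - (p - 1) * x)
  (fun j => / (1 + sgn s * e2pi (x - j * tau)) * / (1 + sgn s * e2pi (x - j * tau)))
  (2 * 2) J); [now apply IZR_lt | exact h | lra |].
intros j hj; rewrite Cmod_mult; apply Rmult_le_compat; auto using Cmod_ge_0.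
Qed.

(** * Numerators as Appell-Lerch sums *)

Lemma sgn_sqr s : sgn s * sgn s = 1.
Proof. destruct s; simpl; ring. Qed.

(** Adding the contributions of [m2] and [m2 + 1] cancels one of the two equal
    denominator factors, because [X + sgn s = sgn s * (1 + sgn s * X)].  At a pole
    both sides vanish, [/ 0] being 0. *)
Lemma F_summand_add s m p tau x y t j :
  F_summand s m p tau x y t j + sgn s * F_summand s m (p + 1) tau x y t j =
  sgn s * (e2pi (m * j ^ 2 * tau + j * (m * (y - x) + p * tau) + (m * t - p * x))
           * / (1 + sgn s * e2pi (x - j * tau))).
Proof.
unfold F_summand; rewrite ZtoC_plus; change (ZtoC 1) with (RtoC 1).
set (X := e2pi (x - j * tau)).
set (A := e2pi (m * j ^ 2 * tau + j * (m * (y - x) + p * tau) + (m * t - p * x))).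
replace (e2pi (m * j ^ 2 * tau + j * (m * (y - x) + (p - 1) * tau)
               + (m * t - (p - 1) * x))) with (A * X)
  by (unfold A, X; rewrite <- e2pi_plus; f_equal; ring).
replace (e2pi (m * j ^ 2 * tau + j * (m * (y - x) + (p + 1 - 1) * tau)
               + (m * t - (p + 1 - 1) * x))) with A
  by (unfold A; f_equal; ring).
set (d := 1 + sgn s * X).
transitivity (A * (X + sgn s) * (/ d * / d)); [ring|].
replace (X + sgn s) with (sgn s * d)
  by (unfold d; transitivity (sgn s + (sgn s * sgn s) * X); [ring | rewrite sgn_sqr; ring]).
destruct (Ceq_dec d 0) as [hd|hd].
- rewrite hd, Cinv_0; ring.
- field; exact hd.
Qed.

(** The shift [epsilon] of the sign: it turns the denominators [1 - X] of
    [Phi1] and [Phi2] into [1 + sgn s * X]. *)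
Definition eps_of (s : sign) : R := match s with Plus => (1 / 2)%R | Minus => 0%R end.

Lemma e2pi_eps s w : e2pi (w + eps_of s) = - sgn s * e2pi w.
Proof.
destruct s; simpl.
- rewrite RtoC_div, e2pi_add_half by lra; ring.
- rewrite Cplus_0_r; ring.
Qed.

(** The common summand of [Phi1] and [Phi2], in the variables in which the two
    sums differ by exchanging [x] and [y]. *)
Definition G_summand (s : sign) (m p : Z) (tau x y t : C) (j : Z) : C :=
  e2pi (m * j ^ 2 * tau + j * (m * (x - y) - p * tau) + (m * t - p * x))
  * / (1 + sgn s * e2pi (x + j * tau)).

Lemma G_summand_summable s m p tau x y t : (0 < m)%Z -> (0 < Im tau)%R ->
  abs_summableZ (G_summand s m p tau x y t).
Proof.
intros hm h; destruct (denominator_bounded s tau x h) as [J hJ].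
apply (gauss_summable (IZR m) tau (m * (x - y) - p * tau) (m * t - p * x)
  (fun j => / (1 + sgn s * e2pi (x + j * tau))) 2 J);
  [now apply IZR_lt | exact h | lra |].
intros j hj.
replace (x + j * tau) with (x - (- j)%Z * tau) by (rewrite ZtoC_opp; ring).
apply hJ; lia.
Qed.

Lemma F_num_add s (m p : Z) tau x y t : (0 < m)%Z -> (0 < Im tau)%R ->
  F_num s m p (point tau (zvec x y) t)
    + sgn s * F_num s m (p + 1) (point tau (zvec x y) t) =
  sgn s * sumZ (G_summand s m p tau x y t).
Proof.
intros hm h; rewrite !F_num_point.
assert (S1 := F_summand_summable s m p tau x y t hm h).
assert (S2 := F_summand_summable s m (p + 1) tau x y t hm h).
assert (SG := G_summand_summable s m p tau x y t hm h).
rewrite <- (sumZ_opp _ SG), <- (sumZ_scal _ _ (abs_summableZ_opp _ SG)).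
rewrite <- (sumZ_scal _ _ S2), <- sumZ_plus; [|exact S1|].
- apply sumZ_ext; intro j; rewrite F_summand_add; unfold G_summand.
  rewrite ZtoC_opp; f_equal; f_equal; [f_equal; ring|].
  do 4 f_equal; ring.
- now apply (abs_summableZ_scal (sgn s) (F_summand s m (p + 1) tau x y t)).
Qed.

(** The value of [e2pi (- (p * eps_of s))], the factor by which the shift by
    [eps_of s] multiplies the terms of [Phi1] and [Phi2]. *)
Definition sign_char (s : sign) (p : Z) : C :=
  match s with Plus => RtoC (powerRZ (-1) p) | Minus => 1 end.

Lemma sign_char_eps s p : (0 <= p)%Z -> e2pi (- (p * eps_of s)) = sign_char s p.
Proof.
intro hp; destruct s; simpl.
- destruct (Z_of_nat_complete p hp) as [n ->].
  rewrite <- pow_powerRZ, RtoC_pow; clear hp; induction n as [|n IH].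
  + simpl; rewrite Cmult_0_l, Copp_0; apply e2pi_0.
  + replace (- (Z.of_nat (S n) * (1 / 2)%R))
      with (- (Z.of_nat n * (1 / 2)%R) - 1 / 2).
    2: { rewrite Nat2Z.inj_succ; unfold Z.succ; rewrite ZtoC_plus, RtoC_div by lra.
         change (ZtoC 1) with (RtoC 1); ring. }
    rewrite e2pi_sub_half, IH; simpl; ring.
- rewrite Cmult_0_r, Copp_0; apply e2pi_0.
Qed.

Lemma sign_char_sqr s p : sign_char s p * sign_char s p = 1.
Proof.
destruct s; simpl; [|ring].
rewrite <- RtoC_mult; f_equal.
rewrite <- powerRZ_mult; replace (-1 * -1)%R with 1%R by ring.
apply powerRZ_R1.
Qed.

Lemma Phi1_G s (m p : Z) tau x y t : (0 < m)%Z -> (0 <= p)%Z -> (0 < Im tau)%R ->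
  Phi1 (IZR m) (IZR (- p)) tau (x + eps_of s) (y - eps_of s) t =
  sign_char s p * sumZ (G_summand s m p tau x (- y) (- t)).
Proof.
intros hm hp h; unfold Phi1.
assert (SG := G_summand_summable s m p tau x (- y) (- t) hm h).
rewrite (sumZ_ext _ (fun j =>
  (sign_char s p * e2pi (m * t)) * G_summand s m p tau x (- y) (- t) j)).
- rewrite sumZ_scal by exact SG.
  transitivity (sign_char s p * (e2pi (- m * t) * e2pi (m * t))
                * sumZ (G_summand s m p tau x (- y) (- t))); [unfold ZtoC; ring|].
  rewrite <- e2pi_plus; replace (- m * t + m * t) with (RtoC 0) by ring.
  rewrite e2pi_0; ring.
- intro j; unfold G_summand, Cdiv, qpow.
  rewrite <- sign_char_eps by exact hp.
  rewrite Cmult_assoc, <- !e2pi_plus.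
  replace (x + eps_of s + j * tau) with (x + j * tau + eps_of s) by ring.
  rewrite e2pi_eps; f_equal.
  + f_equal; change (RtoC (IZR (- p))) with (ZtoC (- p)); rewrite ZtoC_opp.
    unfold ZtoC; ring.
  + f_equal; ring.
Qed.

Lemma Phi2_G s (m p : Z) tau x y t : (0 < m)%Z -> (0 <= p)%Z -> (0 < Im tau)%R ->
  Phi2 (IZR m) (IZR (- p)) tau (x + eps_of s) (y - eps_of s) t =
  sign_char s p * sumZ (G_summand s m p tau (- y) x (- t)).
Proof.
intros hm hp h; unfold Phi2.
assert (SG := G_summand_summable s m p tau (- y) x (- t) hm h).
rewrite (sumZ_ext _ (fun j =>
  (sign_char s p * e2pi (m * t)) * G_summand s m p tau (- y) x (- t) j)).
- rewrite sumZ_scal by exact SG.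
  transitivity (sign_char s p * (e2pi (- m * t) * e2pi (m * t))
                * sumZ (G_summand s m p tau (- y) x (- t))); [unfold ZtoC; ring|].
  rewrite <- e2pi_plus; replace (- m * t + m * t) with (RtoC 0) by ring.
  rewrite e2pi_0; ring.
- intro j; unfold G_summand, Cdiv, qpow.
  rewrite <- sign_char_eps by exact hp.
  rewrite Cmult_assoc, <- !e2pi_plus.
  replace (- (y - eps_of s) + j * tau) with (- y + j * tau + eps_of s) by ring.
  rewrite e2pi_eps; f_equal.
  + f_equal; change (RtoC (IZR (- p))) with (ZtoC (- p)); rewrite ZtoC_opp.
    unfold ZtoC; ring.
  + f_equal; ring.
Qed.

(** [r_theta] exchanges the two coordinates, which is what distinguishes
    [Phi1] from [Phi2]. *)
Lemma num_L_add_Phi s (m p : Z) tau x y t : (0 < m)%Z -> (0 <= p)%Z -> (0 < Im tau)%R ->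
  num_L s m p (point tau (zvec x (- y)) t)
    + sgn s * num_L s m (p + 1) (point tau (zvec x (- y)) t) =
  sgn s * sign_char s p
  * Phi (IZR m) (IZR (- p)) tau (x + eps_of s) (y - eps_of s) (- t).
Proof.
intros hm hp h; unfold num_L, Phi, act; rewrite !r_theta_point.
rewrite (Phi1_G s m p tau x y), (Phi2_G s m p tau x y) by assumption.
replace (- - t) with t by ring.
pose proof (F_num_add s m p tau x (- y) t hm h) as E1.
pose proof (F_num_add s m p tau (- y) x t hm h) as E2.
set (K := sign_char s p).
transitivity (sgn s * sumZ (G_summand s m p tau x (- y) t)
  - sgn s * sumZ (G_summand s m p tau (- y) x t)).
- rewrite <- E1, <- E2; ring.
- transitivity ((K * K) * (sgn s * sumZ (G_summand s m p tau x (- y) t)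
    - sgn s * sumZ (G_summand s m p tau (- y) x t))); [|ring].
  unfold K; rewrite sign_char_sqr; ring.
Qed.

(** The coordinates on which [Psi] is evaluated.  For [typeIII] the reflection
    [r_alpha2] sends [(z1, z2)] to [(- z2, - z1)]. *)
Definition coord1 (ty : heart) (z1 z2 : C) : C :=
  match ty with typeI => z1 | typeIII => - z2 end.
Definition coord2 (ty : heart) (z1 z2 : C) : C :=
  match ty with typeI => - z2 | typeIII => z1 end.

Lemma num_L_adm_point s M m p ty k1 k2 tau z1 z2 t :
  num_L_adm s M m p ty k1 k2 tau (zvec z1 z2) t =
  let u := coord1 ty z1 z2 in
  let v := coord2 ty z1 z2 in
  let k := (k1 + k2)%Z in
  num_L s m p (point (M * tau) (zvec (u + k1 * tau) (- (v + k * tau)))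
                 (1 / M * (t + k * u + k1 * v + k1 * k * tau))).
Proof.
unfold num_L_adm; cbv zeta; rewrite ZtoC_plus.
assert (E : ybar_inv ty (zvec z1 z2 + tau *: beta ty k1 k2)%H =
  zvec (coord1 ty z1 z2 + k1 * tau) (- (coord2 ty z1 z2 + (k1 + k2) * tau))).
{ destruct ty; simpl;
    unfold r_alpha2, form, zvec, hadd, hscal, alpha3, alpha1, alpha2;
    cbn [cL c1 c2 cd]; f_equal; Cfield. }
rewrite E; f_equal; f_equal; f_equal.
destruct ty; simpl; unfold form, zvec, hadd, hscal, alpha3, alpha1, alpha2;
  cbn [cL c1 c2 cd]; Cfield.
Qed.

Lemma Phi_t m s tau x y a b :
  Phi m s tau x y (a + b) = e2pi (- m * a) * Phi m s tau x y b.
Proof.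
unfold Phi, Phi1, Phi2; rewrite Cmult_plus_distr_l, e2pi_plus; ring.
Qed.

Lemma num_Lddot_Psi s (M m p : Z) ty k1 k2 tau z1 z2 t :
  (0 < M)%Z -> (0 < m)%Z -> (0 <= p)%Z -> (0 < Im tau)%R ->
  num_Lddot s M m p ty k1 k2 tau (zvec z1 z2) t =
  sgn s * sign_char s p
  * Psi M (IZR m) (IZR (- p)) (eps_of s) (IZR k1) (IZR (k1 + k2)) tau
      (coord1 ty z1 z2) (coord2 ty z1 z2) (- t).
Proof.
intros hM hm hp h; unfold num_Lddot; rewrite !num_L_adm_point; cbv zeta.
assert (nM : ZtoC M <> 0) by (intro H; apply RtoC_inj, eq_IZR in H; lia).
assert (hT : (0 < Im (M * tau))%R).
{ unfold ZtoC; rewrite im_scal_l; apply Rmult_lt_0_compat; [now apply IZR_lt | exact h]. }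
rewrite num_L_add_Phi by assumption; f_equal; unfold Psi.
set (u := coord1 ty z1 z2); set (v := coord2 ty z1 z2); set (k := (k1 + k2)%Z).
replace (- (1 / M * (t + k * u + k1 * v + k1 * k * tau)))
  with (- (1 / M * (k * u + k1 * v + k1 * k * tau)) + - t / M) by Cfield.
rewrite Phi_t; unfold qpow; rewrite <- e2pi_plus; f_equal; f_equal.
unfold ZtoC in *; Cfield.
Qed.

(** Moving the arguments of [Psi] by multiples of [tau] moves its indices and
    leaves the factor [e2pi (- (m / M) * (t + a v + b u + a b tau))]. *)
Lemma Psi_shift (M : Z) (m s eps j k j' k' : R) (a b : C) tau u v t : (0 < M)%Z ->
  RtoC j' = RtoC j + a -> RtoC k' = RtoC k + b -> t + a * v + b * u + a * b * tau = 0 ->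
  Psi M m s eps j k tau (u + a * tau) (v + b * tau) t =
  Psi M m s eps j' k' tau u v 0.
Proof.
intros hM hj hk ht; unfold Psi.
assert (nM : ZtoC M <> 0) by (intro H; apply RtoC_inj, eq_IZR in H; lia).
rewrite hj, hk.
replace (t / M) with (t / M + 0 / M) by Cfield.
rewrite Phi_t, Cmult_assoc; unfold qpow; rewrite <- !e2pi_plus.
replace (u + a * tau + j * tau) with (u + (j + a) * tau) by ring.
replace (v + b * tau + k * tau) with (v + (k + b) * tau) by ring.
f_equal; f_equal.
replace t with (- (a * v + b * u + a * b * tau)); [Cfield|].
rewrite <- (Cplus_0_l (- _)), <- ht; ring.
Qed.

(** * Reduction and comparison with the N=2 characters *)

(** The function shared by the N=4 and N=2 characters. *)
Definition shifted_Psi s sec (M m p k1 k2 : Z) (tau w : C) : C :=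
  Psi M (IZR m) (IZR (- p)) (eps_of s)
    (match sec with untwisted => (IZR k1 + 1 / 2)%R | twisted => (IZR k1 + 1)%R end)
    (match sec with untwisted => (IZR k2 + 1 / 2)%R | twisted => IZR k2 end)
    tau w (- w) 0.

Lemma ch_H_N2_Psi s sec M m p k1 k2 tau w :
  ch_H_N2 s sec M (m - 1) p k1 k2 tau w =
  sign_char s p * shifted_Psi s sec M m p k1 k2 tau w
  * theta_sector s sec tau w / eta tau ^ 3.
Proof.
unfold ch_H_N2, shifted_Psi; replace (m - 1 + 1)%Z with m by ring.
now destruct s.
Qed.

(** Where the N=2 character is evaluated.  The twist, like [r_alpha2], exchanges
    the coordinates with a sign. *)
Definition reduced_coord (sec : sector) (ty : heart) (z : C) : C :=
  match sec, ty with untwisted, typeI => z | untwisted, typeIII => - z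
                   | twisted, typeI => - z | twisted, typeIII => z end.

Lemma num_Lddot_reduced s sec (M m p : Z) ty k1 k2 tau z :
  (0 < M)%Z -> (0 < m)%Z -> (0 <= p)%Z -> (0 < Im tau)%R ->
  sec = untwisted \/ ty = typeI ->
  num_Lddot_coord s sec M m p ty k1 k2 tau (z + tau / 2) (z - tau / 2) (tau / 4) =
  sgn s * sign_char s p
  * shifted_Psi s sec M m p k1 (k1 + k2) tau (reduced_coord sec ty z).
Proof.
intros hM hm hp h hty; unfold shifted_Psi.
destruct sec; simpl num_Lddot_coord.
- rewrite num_Lddot_Psi by assumption; f_equal.
  set (w := reduced_coord untwisted ty z).
  replace (coord1 ty (z + tau / 2) (z - tau / 2)) with (w + 1 / 2 * tau)
    by (unfold w; destruct ty; simpl; Cfield).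
  replace (coord2 ty (z + tau / 2) (z - tau / 2)) with (- w + 1 / 2 * tau)
    by (unfold w; destruct ty; simpl; Cfield).
  apply Psi_shift; [exact hM | rewrite RtoC_plus, RtoC_div by lra; reflexivity ..|].
  Cfield.
- destruct hty as [hty| ->]; [discriminate|].
  unfold twist; rewrite num_Lddot_Psi by assumption; f_equal; simpl.
  replace (- (z - tau / 2) + tau / 2) with (- z + 1 * tau) by Cfield.
  replace (- (- (z + tau / 2) + tau / 2)) with (- - z + 0 * tau) by Cfield.
  apply Psi_shift; [exact hM | now rewrite RtoC_plus | now rewrite Cplus_0_r |].
  Cfield.
Qed.

Lemma theta_ratio s sec tau z : (0 < Im tau)%R ->
  Ci * theta_sector s sec tau z / theta 1 1 tau (2 * z) =
  - theta_phase s sec tau z * e2pi (z - tau / 8)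
  * (theta_numerator s sec tau z / Dprod tau z).
Proof.
intro h; destruct (jacobi_triple_product tau z h) as [hE _].
rewrite theta_11_double, theta_sector_prod by exact h.
replace (z - tau / 8) with (- (tau / 8 - z)) by ring; rewrite e2pi_opp.
unfold Cdiv; rewrite !Cinv_mult.
set (D := / Dprod tau z).
pose proof Ci_nz; pose proof (e2pi_neq0 (tau / 8 - z)).
field; repeat split; auto.
Qed.

(** The sign [c] is the parity of the theta function, which the N=2 character at
    [- z] carries and the N=4 denominator at [z] does not. *)
Lemma ch_Hddot_N4_N2 s sec (M m p : Z) ty k1 k2 tau z (c : C) :
  (0 < M)%Z -> (0 < m)%Z -> (0 <= p)%Z -> (0 < Im tau)%R ->
  sec = untwisted \/ ty = typeI ->
  theta_sector s sec tau (reduced_coord sec ty z) = c * theta_sector s sec tau z ->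
  c * c = 1 ->
  ch_Hddot_N4 s sec M m p ty k1 k2 tau z =
  - (c * theta_phase s sec tau z * e2pi (z - tau / 8))
  * ch_H_N2 s sec M (m - 1) p k1 (k1 + k2) tau (reduced_coord sec ty z)
  * (theta_numerator s sec tau z / Dprod tau z).
Proof.
intros hM hm hp h hty hc hcc.
transitivity (c * ch_H_N2 s sec M (m - 1) p k1 (k1 + k2) tau (reduced_coord sec ty z)
              * (Ci * theta_sector s sec tau z / theta 1 1 tau (2 * z))).
2: { rewrite theta_ratio by exact h; ring. }
rewrite ch_H_N2_Psi, hc.
unfold ch_Hddot_N4; rewrite num_Lddot_reduced by assumption.
unfold R_N4, Cdiv; rewrite !Cinv_mult, Cinv_involutive.
set (P := shifted_Psi _ _ _ _ _ _ _ _ _); set (th := theta_sector s sec tau z).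
set (e := / eta tau ^ 3); set (t := / theta 1 1 tau (2 * z)); set (K := sign_char s p).
replace (/ - sgn s * / Ci) with (sgn s * Ci).
2: { rewrite Ci_inv; destruct s; simpl; field; apply C1_nz. }
transitivity ((sgn s * sgn s) * (K * P * Ci * e * t * th ^ 2)); [ring|].
transitivity ((c * c) * (K * P * Ci * e * t * th ^ 2)); [|ring].
now rewrite sgn_sqr, hcc.
Qed.

(* D(tau, z) = 0 exactly when 2z lies in Z + Z tau, and all poles of the
   characters lie there; the identities are between meromorphic functions of z. *)
Theorem corollary5p2 (M m m2 : Z)
    (hM : (0 < M)%Z) (hm : (0 < m)%Z) (hcop : Z.gcd M m = 1%Z)
    (hm2 : (0 <= m2 <= m - 1)%Z)
    (tau z : C) (htau : (0 < Im tau)%R)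
    (hz : forall a b : Z, 2 * z <> a + b * tau) :
  (forall k1 k2 : Z, Omega typeI M k1 k2 ->
     ch_Hddot_N4 Plus untwisted M m m2 typeI k1 k2 tau z =
       - qpow tau (- (1 / 8)) * e2pi z
       * ch_H_N2 Plus untwisted M (m - 1) m2 k1 (k1 + k2) tau z
       * (Cprod (fun n => (1 + e2pi z * qpow tau (INR n - 1 / 2))
                          * (1 + e2pi (- z) * qpow tau (INR n - 1 / 2)))
          / Dprod tau z)
     /\
     ch_Hddot_N4 Minus untwisted M m m2 typeI k1 k2 tau z =
       - qpow tau (- (1 / 8)) * e2pi z
       * ch_H_N2 Minus untwisted M (m - 1) m2 k1 (k1 + k2) tau z
       * (Cprod (fun n => (1 - e2pi z * qpow tau (INR n - 1 / 2))
                          * (1 - e2pi (- z) * qpow tau (INR n - 1 / 2)))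
          / Dprod tau z))
  /\
  (forall k1 k2 : Z, Omega typeIII M k1 k2 ->
     ch_Hddot_N4 Plus untwisted M m m2 typeIII k1 k2 tau z =
       - qpow tau (- (1 / 8)) * e2pi z
       * ch_H_N2 Plus untwisted M (m - 1) m2 k1 (k1 + k2) tau (- z)
       * (Cprod (fun n => (1 + e2pi z * qpow tau (INR n - 1 / 2))
                          * (1 + e2pi (- z) * qpow tau (INR n - 1 / 2)))
          / Dprod tau z)
     /\
     ch_Hddot_N4 Minus untwisted M m m2 typeIII k1 k2 tau z =
       - qpow tau (- (1 / 8)) * e2pi z
       * ch_H_N2 Minus untwisted M (m - 1) m2 k1 (k1 + k2) tau (- z)
       * (Cprod (fun n => (1 - e2pi z * qpow tau (INR n - 1 / 2))
                          * (1 - e2pi (- z) * qpow tau (INR n - 1 / 2)))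
          / Dprod tau z))
  /\
  (forall k1 k2 : Z, Omega typeI M k1 k2 ->
     ch_Hddot_N4 Plus twisted M m m2 typeI k1 k2 tau z =
       - e2pi (z / 2)
       * ch_H_N2 Plus twisted M (m - 1) m2 k1 (k1 + k2) tau (- z)
       * (Cprod (fun n => (1 + e2pi z * qpow tau (INR n - 1))
                          * (1 + e2pi (- z) * qpow tau (INR n)))
          / Dprod tau z)
     /\
     ch_Hddot_N4 Minus twisted M m m2 typeI k1 k2 tau z =
       - Ci * e2pi (z / 2)
       * ch_H_N2 Minus twisted M (m - 1) m2 k1 (k1 + k2) tau (- z)
       * (Cprod (fun n => (1 - e2pi z * qpow tau (INR n - 1))
                          * (1 - e2pi (- z) * qpow tau (INR n)))
          / Dprod tau z)).
Proof.
assert (hp : (0 <= m2)%Z) by lia.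
assert (U : forall s ty k1 k2,
  ch_Hddot_N4 s untwisted M m m2 ty k1 k2 tau z =
  - qpow tau (- (1 / 8)) * e2pi z
  * ch_H_N2 s untwisted M (m - 1) m2 k1 (k1 + k2) tau (reduced_coord untwisted ty z)
  * (theta_numerator s untwisted tau z / Dprod tau z)).
{ intros s ty k1 k2.
  rewrite (ch_Hddot_N4_N2 s untwisted M m m2 ty k1 k2 tau z 1); auto; [| |ring].
  - replace (theta_phase s untwisted tau z) with (RtoC 1) by now destruct s.
    unfold qpow; replace (z - tau / 8) with (- (1 / 8) * tau + z) by Cfield.
    rewrite e2pi_plus; ring.
  - destruct ty; simpl reduced_coord; [ring|].
    rewrite theta_sector_parity by exact htau; now destruct s. }
assert (T : forall s (k1 k2 : Z), let c := match s with Plus => RtoC 1 | Minus => Ci end in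
  ch_Hddot_N4 s twisted M m m2 typeI k1 k2 tau z =
  - c * e2pi (z / 2)
  * ch_H_N2 s twisted M (m - 1) m2 k1 (k1 + k2) tau (- z)
  * (theta_numerator s twisted tau z / Dprod tau z)).
{ intros s k1 k2.
  rewrite (ch_Hddot_N4_N2 s twisted M m m2 typeI k1 k2 tau z (sgn s));
    auto using sgn_sqr.
  - replace (z / 2) with (tau / 8 - z / 2 + (z - tau / 8)) by Cfield.
    rewrite e2pi_plus; destruct s; simpl; ring.
  - simpl reduced_coord; rewrite theta_sector_parity by exact htau; now destruct s. }
split; [|split]; intros k1 k2 _; split.
1-4: rewrite U; f_equal; f_equal; apply Cprod_ext; intro n; simpl sgn; ring.
- rewrite T; f_equal; [ring|].
  f_equal; apply Cprod_ext; intro n; simpl sgn; ring.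
- rewrite T; f_equal; f_equal; apply Cprod_ext; intro n; simpl sgn; ring.
Qed.
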